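(* Let $F$ be Thompson's group of the dyadic interval, acting on the set $I=\mathbf{Z}[1/2]\cap(0,1)$ of dyadic numbers contained in the open interval $(0,1)$. The groups $\mathbf{Z}\wr_I F$ and $D_\infty\wr_I F$ are finitely presented and are bi-Lipschitz-equivalent. The first group $\mathbf{Z}\wr_I F$ is torsion-free, while the second group $D_\infty\wr_I F$ contains an infinite subgroup of exponent $2$.
   Context: $F$ is the group of piecewise linear increasing homeomorphisms of $[0,1]$ with (finitely many) singularities, all lying in $\mathbf{Z}[1/2]\cap[0,1]$, and with all slopes powers of $2$; it acts on $I$ by evaluation. $D_\infty$ denotes the infinite dihedral group. For a group $W$ and a $G$-set $X$, the permutational wreath product $W\wr_X G$ is the semidirect product $W^{(X)}\rtimes G$, where $W^{(X)}$ is the group of finitely supported functions $X\to W$ and $G$ acts by $(g\cdot f)(x)=f(g^{-1}x)$. Two finitely generated groups are bi-Lipschitz-equivalent if there is a bijection between them which is bi-Lipschitz for the word metrics associated with finite generating subsets. *)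

(* Defs.v *)
From HB Require Import structures.
From mathcomp Require Import all_boot all_order all_algebra finmap.
From mathcomp Require Import ring.
From mathcomp Require Import all_classical all_reals all_analysis.
Set Implicit Arguments.
Unset Strict Implicit.
Unset Printing Implicit Defensive.
Import Order.TTheory GRing.Theory Num.Theory.
Import numFieldNormedType.Exports.
Local Open Scope classical_set_scope.
Local Open Scope ring_scope.

Section Words.
Local Open Scope group_scope.

(* The letter (i, false) stands for the i-th generator, (i, true) for its
   inverse. *)
Definition word (n : nat) : Type := seq ('I_n * bool).

Definition word_eval (G : groupType) (n : nat) (a : 'I_n -> G) (w : word n) : G :=
  \prod_(l <- w) (if l.2 then (a l.1)^-1 else a l.1).

(* Equality of words in the group presented by < 'I_n | r >. *)
Inductive pres_eq (n : nat) (r : seq (word n)) : word n -> word n -> Prop :=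
| pres_refl u : pres_eq r u u
| pres_sym u v : pres_eq r u v -> pres_eq r v u
| pres_trans u v w : pres_eq r u v -> pres_eq r v w -> pres_eq r u w
| pres_free u v i b :
    pres_eq r (u ++ [:: (i, b); (i, ~~ b)] ++ v) (u ++ v)
| pres_rel u v w : w \in r -> pres_eq r (u ++ w ++ v) (u ++ v).

Definition generates (G : groupType) (n : nat) (a : 'I_n -> G) : Prop :=
  forall g : G, exists w : word n, word_eval a w = g.

Definition finitely_presented (G : groupType) : Prop :=
  exists (n : nat) (a : 'I_n -> G) (r : seq (word n)),
    generates a /\
    forall u v : word n, word_eval a u = word_eval a v <-> pres_eq r u v.

Section WordMetric.
Variables (G : groupType) (n : nat) (a : 'I_n -> G) (gen : generates a).

Lemma word_length_exists (g : G) :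
  exists m, `[< exists2 w : word n, word_eval a w = g & size w = m >].
Proof. by have [w wg] := gen g; exists (size w); apply/asboolP; exists w. Qed.

Definition word_length (g : G) : nat := ex_minn (word_length_exists g).

Definition word_dist (g h : G) : nat := word_length (g^-1 * h).
End WordMetric.

(* A natural bi-Lipschitz constant is no restriction: any real one can be
   rounded up. Finite generating subsets are given as finite families. *)
Definition bilipschitz_equivalent (G H : groupType) : Prop :=
  exists (m n : nat) (a : 'I_m -> G) (b : 'I_n -> H)
         (gena : generates a) (genb : generates b) (phi : G -> H) (C : nat),
    bijective phi /\
    forall x y : G,
      (word_dist genb (phi x) (phi y) <= C * word_dist gena x y)%N /\
      (word_dist gena x y <= C * word_dist genb (phi x) (phi y))%N.

Definition torsion_free (G : groupType) : Prop :=
  forall (g : G) (n : nat), (0 < n)%N -> g ^+ n = 1 -> g = 1.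

Definition has_exponent (G : groupType) (H : set G) (n : nat) : Prop :=
  [/\ (0 < n)%N, forall x, H x -> x ^+ n = 1 &
      forall m, (0 < m)%N -> (forall x, H x -> x ^+ m = 1) -> (n <= m)%N].

Record gaction (G : groupType) (X : Type) := GAction {
  gact :> G -> X -> X;
  gact1 : forall x, gact 1 x = x;
  gactM : forall g h x, gact (g * h) x = gact g (gact h x) }.

Record autaction (G N : groupType) := AutAction {
  autact :> gaction G N;
  autactM : forall g, {morph autact g : x y / x * y} }.

End Words.

(* phi only enters the multiplication defined below. *)
Record semidirect (N G : groupType) (phi : autaction G N) :=
  Semidirect { sd_left : N; sd_right : G }.

Section Semidirect.
Local Open Scope group_scope.
Variables (N G : groupType) (phi : autaction G N).

Definition semidirect_pair (x : semidirect phi) := (sd_left x, sd_right x).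
Definition pair_semidirect (x : N * G) := Semidirect phi x.1 x.2.
Lemma semidirect_pairK : cancel semidirect_pair pair_semidirect.
Proof. by case. Qed.

HB.instance Definition _ := Choice.copy (semidirect phi) (can_type semidirect_pairK).

Definition sd_one := Semidirect phi 1 1.
Definition sd_mul (x y : semidirect phi) :=
  Semidirect phi (sd_left x * phi (sd_right x) (sd_left y)) (sd_right x * sd_right y).
Definition sd_inv (x : semidirect phi) :=
  Semidirect phi (phi (sd_right x)^-1 (sd_left x)^-1) (sd_right x)^-1.

Lemma autact_1 g : phi g 1 = 1.
Proof. by apply: (mulgI (phi g 1)); rewrite -autactM !mulg1. Qed.

Lemma sd_mulA : associative sd_mul.
Proof.
by case=> [a g] [b h] [c k]; rewrite /sd_mul /= autactM gactM !mulgA.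
Qed.
Lemma sd_mul1 : left_id sd_one sd_mul.
Proof. by case=> a g; rewrite /sd_mul /= gact1 !mul1g. Qed.
Lemma sd_mulr1 : right_id sd_one sd_mul.
Proof. by case=> a g; rewrite /sd_mul /= autact_1 !mulg1. Qed.
Lemma sd_mulV : left_inverse sd_one sd_inv sd_mul.
Proof. by case=> a g; rewrite /sd_mul /= -autactM !mulVg autact_1. Qed.
Lemma sd_mulrV : right_inverse sd_one sd_inv sd_mul.
Proof. by case=> a g; rewrite /sd_mul /= -gactM !mulgV gact1 mulgV. Qed.

HB.instance Definition _ := isGroup.Build (semidirect phi)
  sd_mulA sd_mul1 sd_mulr1 sd_mulV sd_mulrV.
End Semidirect.

Section FinSuppGroup.
Local Open Scope group_scope.
Local Open Scope fset_scope.
Variables (X : choiceType) (W : groupType).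

Definition fs_group := {fsfun X -> W of _ => 1}.

HB.instance Definition _ := Choice.on fs_group.

Definition fs_one : fs_group := [fsfun of _ => 1].
Definition fs_mul (f g : fs_group) : fs_group :=
  [fsfun x in finsupp f `|` finsupp g => f x * g x | 1].
Definition fs_inv (f : fs_group) : fs_group :=
  [fsfun x in finsupp f => (f x)^-1 | 1].

Lemma fs_oneE x : fs_one x = 1.
Proof. by rewrite fsfunE. Qed.
Lemma fs_mulE f g x : fs_mul f g x = f x * g x.
Proof.
rewrite fsfunE in_fsetU.
by case: (finsuppP f x) => //= _; case: finsuppP => //= _; rewrite mul1g.
Qed.
Lemma fs_invE f x : fs_inv f x = (f x)^-1.
Proof. by rewrite fsfunE; case: finsuppP => //=; rewrite invg1. Qed.

Lemma fs_mulA : associative fs_mul.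
Proof. by move=> f g h; apply/fsfunP => x; rewrite !fs_mulE mulgA. Qed.
Lemma fs_mul1 : left_id fs_one fs_mul.
Proof. by move=> f; apply/fsfunP => x; rewrite fs_mulE fs_oneE mul1g. Qed.
Lemma fs_mulr1 : right_id fs_one fs_mul.
Proof. by move=> f; apply/fsfunP => x; rewrite fs_mulE fs_oneE mulg1. Qed.
Lemma fs_mulV : left_inverse fs_one fs_inv fs_mul.
Proof. by move=> f; apply/fsfunP => x; rewrite fs_mulE fs_invE fs_oneE mulVg. Qed.
Lemma fs_mulrV : right_inverse fs_one fs_inv fs_mul.
Proof. by move=> f; apply/fsfunP => x; rewrite fs_mulE fs_invE fs_oneE mulgV. Qed.

HB.instance Definition _ := isGroup.Build fs_group
  fs_mulA fs_mul1 fs_mulr1 fs_mulV fs_mulrV.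
End FinSuppGroup.

Section Wreath.
Local Open Scope group_scope.
Variables (W G : groupType) (X : choiceType) (a : gaction G X).

(* The support of g f is g (supp f). *)
Definition wr_act (g : G) (f : fs_group X W) : fs_group X W :=
  [fsfun x in [fset a g y | y in finsupp f]%fset => f (a g^-1 x) | 1].

Lemma wr_actE g f x : wr_act g f x = f (a g^-1 x).
Proof.
rewrite fsfunE; case: ifPn => // /imfsetP h.
case: finsuppP => // ys; case: h; exists (a g^-1 x) => //=.
by rewrite -gactM mulgV gact1.
Qed.

Lemma wr_act1 f : wr_act 1 f = f.
Proof. by apply/fsfunP => x; rewrite wr_actE invg1 gact1. Qed.
Lemma wr_actM g h f : wr_act (g * h) f = wr_act g (wr_act h f).
Proof. by apply/fsfunP => x; rewrite !wr_actE invgM gactM. Qed.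
Lemma wr_act_morph g : {morph wr_act g : f h / f * h}.
Proof. by move=> f h; apply/fsfunP => x; rewrite !(wr_actE, fs_mulE). Qed.

Definition wr_autaction : autaction G (fs_group X W) :=
  @AutAction _ _ (GAction wr_act1 wr_actM) wr_act_morph.

Definition wreath := semidirect wr_autaction.
HB.instance Definition _ := Group.on wreath.
End Wreath.

Section Dihedral.

(* The additive groups Z and Z/2 (bool with exclusive or), written
   multiplicatively. *)
Definition Zgroup := Algebra.to_multiplicative int.
HB.instance Definition _ := Group.on Zgroup.
Definition C2group := Algebra.to_multiplicative bool.
HB.instance Definition _ := Group.on C2group.

Definition sign_act (b : C2group) (m : Zgroup) : Zgroup :=
  if b then - (m : int) else m.
Lemma sign_act1 m : sign_act 1%g m = m.
Proof. by []. Qed.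
Lemma sign_actM b c m : sign_act (b * c)%g m = sign_act b (sign_act c m).
Proof. by case: b; case: c => //=; rewrite /sign_act /= opprK. Qed.
Lemma sign_act_morph b : {morph sign_act b : m n / (m * n)%g}.
Proof. by case: b => // m n; exact: (opprD (m : int) n). Qed.

Definition sign_autaction : autaction C2group Zgroup :=
  @AutAction _ _ (GAction sign_act1 sign_actM) sign_act_morph.

Definition Dinf := semidirect sign_autaction.
HB.instance Definition _ := Group.on Dinf.
End Dihedral.

Section Thompson.
Variable R : realType.

Definition unit_interval : set R := [set x | 0 <= x <= 1].
Local Notation I01 := (set_type unit_interval).

Definition dyadic (x : R) : Prop :=
  exists (m : int) (n : nat), x = m%:~R / 2 ^+ n.

Definition homeomorphism (f : I01 -> I01) : Prop :=
  exists g : I01 -> I01,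
    [/\ continuous f, continuous g, cancel f g & cancel g f].

Definition increasing (f : I01 -> I01) : Prop :=
  forall x y : I01, val x < val y -> val (f x) < val (f y).

(* f is affine on every segment with no point of s in its interior, that is, s
   contains all the singularities of f (and possibly other dyadic points). *)
Definition dyadic_piecewise_linear (f : I01 -> I01) : Prop :=
  exists s : seq I01,
    (forall t, t \in s -> dyadic (val t)) /\
    forall a b : I01, val a < val b ->
      (forall t, t \in s -> ~~ (val a < val t < val b)) ->
      exists (k : int) (c : R), forall x : I01,
        val a <= val x <= val b -> val (f x) = 2 ^ k * val x + c.

Definition is_thompson (f : I01 -> I01) : Prop :=
  [/\ homeomorphism f, increasing f & dyadic_piecewise_linear f].

Lemma dyadic0 : dyadic 0.
Proof. by exists 0, 0%N; rewrite mul0r. Qed.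
Lemma dyadicD x y : dyadic x -> dyadic y -> dyadic (x + y).
Proof.
move=> [m [n ->]] [p [q ->]]; exists (m * 2 ^+ q + p * 2 ^+ n), (n + q)%N.
have h k : 2 ^+ k != 0 :> R by rewrite expf_neq0// pnatr_eq0.
rewrite rmorphD !rmorphM !rmorphXn /= exprD; move: (h n) (h q).
by move: (2 ^+ n) (2 ^+ q) => a b a0 b0; field; rewrite a0 b0.
Qed.
Lemma dyadicN x : dyadic x -> dyadic (- x).
Proof. by move=> [m [n ->]]; exists (- m), n; rewrite rmorphN mulNr. Qed.
Lemma dyadicZ (k : int) x : dyadic x -> dyadic (2 ^ k * x).
Proof.
move=> [m [n ->]]; case: k => k.
  by exists (2 ^+ k * m), n; rewrite rmorphM rmorphXn /= mulrA.
exists m, (k.+1 + n)%N.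
by rewrite /exprz exprD invfM mulrCA.
Qed.

Lemma I01_0 : 0 \in unit_interval.
Proof. by apply/mem_set; rewrite /unit_interval /= lexx ler01. Qed.
Definition pt0 : I01 := exist _ 0 I01_0.

Lemma I01_ge0 (x : I01) : 0 <= val x.
Proof. by case: x => x /= /set_mem /andP[]. Qed.

Lemma increasing_le f : increasing f ->
  forall x y : I01, (val (f x) <= val (f y)) = (val x <= val y).
Proof.
move=> inc x y; case: (ltgtP (val x) (val y)) => [/inc/ltW->//|/inc|/val_inj->].
  by rewrite ltNge => /negbTE.
by rewrite lexx.
Qed.
Lemma increasing_lt f : increasing f ->
  forall x y : I01, (val (f x) < val (f y)) = (val x < val y).
Proof. by move=> inc x y; rewrite !ltNge increasing_le. Qed.

Lemma thompson_pt0 f : is_thompson f -> f pt0 = pt0.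
Proof.
case=> -[g [_ _ fK gK]] inc _; apply/val_inj/eqP; rewrite eq_le.
rewrite [X in _ && X]I01_ge0 andbT -[X in _ <= val X]gK.
by rewrite increasing_le// I01_ge0.
Qed.

Lemma thompson_dyadic f (x : I01) :
  is_thompson f -> dyadic (val x) -> dyadic (val (f x)).
Proof.
move=> Ff dx; have f0 := thompson_pt0 Ff; case: Ff => _ inc [s [sd sP]].
pose B (y x : I01) := [seq t <- s | val y < val t < val x].
suff H n (y z : I01) : (size (B y z) < n)%N -> val y < val z ->
    dyadic (val y) -> dyadic (val z) -> dyadic (val (f y)) ->
    dyadic (val (f z)).
  case: (eqVneq x pt0) => [->|x0]; first by rewrite f0; exact: dyadic0.
  apply: (H _ pt0 x (ltnSn _)) => //; last 2 first.
  - exact: dyadic0.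
  - by rewrite f0; exact: dyadic0.
  by rewrite lt_neqAle (I01_ge0 x) andbT (inj_eq val_inj) eq_sym.
elim: n y z => // n IH y z Bn yz dy dz dfy.
have [/hasP[t ts tyz]|/hasPn nB] := boolP (has (fun t => val y < val t < val z) s).
  have /andP[yt tz] := tyz.
  have sub (u v : I01) : val y <= val u -> val v <= val z ->
      ~~ (val u < val t < val v) -> (size (B u v) < n)%N.
    move=> yu vz tuv; apply: (@leq_trans (size (B y z))); last exact: Bn.
    have -> : B u v = [seq r <- B y z | val u < val r < val v].
      rewrite -filter_predI; apply: eq_filter => r /=.
      case: (boolP (_ < _ < _)) => //= /andP[ur rv].
      by rewrite (le_lt_trans yu ur) (lt_le_trans rv vz).
    rewrite size_filter ltn_neqAle count_size andbT -all_count.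
    by apply/allPn; exists t; rewrite // mem_filter tyz.
  have dft : dyadic (val (f t)).
    by apply: (IH y t) => //; [apply: sub; rewrite ?ltxx ?andbF//; exact: ltW|exact: sd].
  by apply: (IH t z) => //; [apply: sub; rewrite ?ltxx//; exact: ltW|exact: sd].
have [k [c E]] := sP _ _ yz nB.
have -> : val (f z) = val (f y) + 2 ^ k * (val z - val y).
  rewrite !E ?lexx ?(ltW yz)// mulrBr; ring.
by apply: dyadicD => //; apply: dyadicZ; apply: dyadicD => //; exact: dyadicN.
Qed.

Lemma is_thompson_id : is_thompson id.
Proof.
split=> //; first by exists id; split=> // x; exact: cvg_id.
exists [::]; split=> // a b _ _; exists 0, 0 => x _.
by rewrite expr0z mul1r addr0.
Qed.

Lemma is_thompson_inv f g : is_thompson f -> cancel f g -> is_thompson g.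
Proof.
move=> Ff fK; have [[g' [cf cg' fK' g'K]] inc [s [sd sP]]] := Ff.
have gg' : g = g' by apply/funext => x; rewrite -[x in LHS]g'K fK.
subst g'; have incg : increasing g.
  by move=> x y xy; rewrite -(increasing_lt inc) !g'K.
split=> //; first by exists f.
exists (map f s); split=> [t /mapP[u us ->]|a b ab nab].
  by apply: thompson_dyadic => //; exact: sd.
have [t ts|k [c E]] := sP (g a) (g b) (incg _ _ ab).
  have := nab (f t) (map_f f ts).
  by rewrite -(increasing_lt incg a) -(increasing_lt incg (f t)) fK.
exists (- k), (- (2 ^ (- k) * c)) => x xab.
have := E (g x); rewrite g'K !(increasing_le incg) => /(_ xab) ->.
by rewrite mulrDr mulrA -expfzDr ?pnatr_eq0// addNr expr0z mul1r addrK.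
Qed.

Lemma is_thompson_comp f h : is_thompson f -> is_thompson h ->
  is_thompson (f \o h).
Proof.
move=> Ff Fh; have [[f' [cf cf' fK f'K]] incf [sf [sfd sfP]]] := Ff.
have [[h' [ch ch' hK h'K]] inch [sh [shd shP]]] := Fh.
have Fh' := is_thompson_inv Fh hK.
split; [exists (h' \o f'); split| |].
- by move=> x; apply: continuous_comp; [exact: ch|exact: cf].
- by move=> x; apply: continuous_comp; [exact: cf'|exact: ch'].
- by move=> x /=; rewrite fK hK.
- by move=> x /=; rewrite h'K f'K.
- by move=> x y xy /=; apply/incf/inch.
exists (sh ++ map h' sf); split=> [t|a b ab nab].
  rewrite mem_cat => /orP[/shd//|/mapP[u us ->]].
  by apply: thompson_dyadic => //; exact: sfd.
have [t ts|k [c E]] := shP a b ab; first by apply: nab; rewrite mem_cat ts.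
have [t ts|l [d E']] := sfP (h a) (h b) (inch _ _ ab).
  have := nab (h' t); rewrite mem_cat map_f ?orbT// => /(_ isT).
  by rewrite -(increasing_lt inch a) -(increasing_lt inch (h' t)) h'K.
exists (l + k), (2 ^ l * c + d) => x xab /=.
rewrite E' ?(increasing_le inch)// E// expfzDr ?pnatr_eq0//.
by rewrite mulrDr mulrA addrA.
Qed.

Definition thompsonF : Type := {f : I01 -> I01 | `[< is_thompson f >]}.
HB.instance Definition _ := Choice.on thompsonF.

Lemma thompsonP (f : thompsonF) : is_thompson (val f).
Proof. by case: f => f /= /asboolP. Qed.

Definition F_of f (Ff : is_thompson f) : thompsonF :=
  exist _ f (asboolT Ff).

Lemma thompson_inv_exists (f : thompsonF) :
  exists g, [/\ is_thompson g, cancel (val f) g & cancel g (val f)].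
Proof.
have [[g [_ _ fK gK]] _ _] := thompsonP f; exists g; split=> //.
exact: is_thompson_inv (thompsonP f) fK.
Qed.
Definition F_invfun (f : thompsonF) : I01 -> I01 := sval (cid (thompson_inv_exists f)).
Lemma F_invfunP f :
  [/\ is_thompson (F_invfun f), cancel (val f) (F_invfun f) &
      cancel (F_invfun f) (val f)].
Proof. by rewrite /F_invfun; case: cid. Qed.
Lemma F_invfun_thompson f : is_thompson (F_invfun f).
Proof. by case: (F_invfunP f). Qed.

Definition F_one : thompsonF := F_of is_thompson_id.
Definition F_mul (f g : thompsonF) : thompsonF :=
  F_of (is_thompson_comp (thompsonP f) (thompsonP g)).
Definition F_inv (f : thompsonF) : thompsonF := F_of (F_invfun_thompson f).

Lemma F_mulA : associative F_mul.
Proof. by move=> f g h; apply: val_inj. Qed.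
Lemma F_mul1 : left_id F_one F_mul.
Proof. by move=> f; apply: val_inj. Qed.
Lemma F_mulr1 : right_id F_one F_mul.
Proof. by move=> f; apply: val_inj. Qed.
Lemma F_mulV : left_inverse F_one F_inv F_mul.
Proof.
move=> f; apply: val_inj; apply/funext => x /=.
by have [_ fK _] := F_invfunP f; exact: fK.
Qed.
Lemma F_mulrV : right_inverse F_one F_inv F_mul.
Proof.
move=> f; apply: val_inj; apply/funext => x /=.
by have [_ _ fK] := F_invfunP f; exact: fK.
Qed.

HB.instance Definition _ := isGroup.Build thompsonF
  F_mulA F_mul1 F_mulr1 F_mulV F_mulrV.

Definition dyadic_interior : Type :=
  {x : I01 | `[< dyadic (val x) /\ 0 < val x < 1 >]}.
HB.instance Definition _ := Choice.on dyadic_interior.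

Lemma I01_1 : 1 \in unit_interval.
Proof. by apply/mem_set; rewrite /unit_interval /= lexx ler01. Qed.
Definition pt1 : I01 := exist _ 1 I01_1.
Lemma I01_le1 (x : I01) : val x <= 1.
Proof. by case: x => x /= /set_mem /andP[]. Qed.

Lemma thompson_pt1 f : is_thompson f -> f pt1 = pt1.
Proof.
case=> -[g [_ _ fK gK]] inc _; apply/val_inj/eqP; rewrite eq_le I01_le1 /=.
have : val (f (g pt1)) <= val (f pt1) by rewrite increasing_le// I01_le1.
by rewrite gK.
Qed.

Lemma eval_subproof (f : thompsonF) (x : dyadic_interior) :
  `[< dyadic (val (val f (val x))) /\ 0 < val (val f (val x)) < 1 >].
Proof.
case: x => x /= /asboolP[dx /andP[x0 x1]]; apply/asboolP.
have Ff := thompsonP f; have [_ inc _] := Ff; split; first exact: thompson_dyadic.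
apply/andP; split.
  rewrite -[0]/(val pt0) -(thompson_pt0 Ff) (increasing_lt inc); exact: x0.
rewrite -[1]/(val pt1) -(thompson_pt1 Ff) (increasing_lt inc); exact: x1.
Qed.

Definition evalF (f : thompsonF) (x : dyadic_interior) : dyadic_interior :=
  exist _ (val f (val x)) (eval_subproof f x).

Lemma evalF1 x : evalF 1%g x = x.
Proof. exact: val_inj. Qed.
Lemma evalFM f g x : evalF (f * g)%g x = evalF f (evalF g x).
Proof. exact: val_inj. Qed.

Definition eval_action : gaction thompsonF dyadic_interior :=
  GAction evalF1 evalFM.
End Thompson.

(* Main.v *)
Require Import Defs.
From HB Require Import structures.
From mathcomp Require Import all_boot all_order all_algebra finmap.
From mathcomp Require Import ring lra zify.
From mathcomp Require Import all_classical all_reals all_analysis.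
Set Implicit Arguments.
Unset Strict Implicit.
Unset Printing Implicit Defensive.
Import Order.TTheory GRing.Theory Num.Theory.
Import numFieldNormedType.Exports.

(* With c_n = 1 - 2^-n, let x_n in F be the generator supported on [c_n, 1], so
   that x_k x_n = x_(n+1) x_k for k < n, and let w_j be the copy of W at
   c_(j+1); then x_i w_j x_i^-1 is w_j if j < i and w_(j+1) otherwise, and
   distinct copies commute.  These relations present W wr_I F:

   - they rewrite every word as q^-1 d p, with p, q positive words in the x_i
     and d a product of lamps;
   - positive words sort into non-increasing ones, and a sorted word is
     determined by its action on the c_n, so if the word is trivial in the wreath
     product, then p = q and d = 1 follow from the relations;
   - for f in F, a fine uniform dyadic partition is mapped affinely to another
     partition into standard dyadic intervals.  Collapsing pairs of sibling
     intervals, positive words p and q map these partitions to the one cut out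
     by the c_n, whence f = q^-1 p; the same p moves any dyadic point to some
     c_n.

   Conjugation by x_0 reduces the infinite presentation to finitely many
   relators.  Finally, the Cayley graphs of Z and of D_oo with two reflections
   as generators are both lines, and applying the graph isomorphism pointwise to
   lamp configurations is an isometry of the wreath products. *)

(** * Presentations *)

Section WordEval.
Local Open Scope group_scope.
Variables (G : groupType) (n : nat) (a : 'I_n -> G).
Implicit Types u v w : word n.

Definition letter_eval (l : 'I_n * bool) : G := if l.2 then (a l.1)^-1 else a l.1.

Lemma word_eval_nil : word_eval a [::] = 1.
Proof. by rewrite /word_eval big_nil. Qed.
Lemma word_eval_cons l w : word_eval a (l :: w) = letter_eval l * word_eval a w.
Proof. by rewrite /word_eval big_cons. Qed.
Lemma word_eval_cat u v : word_eval a (u ++ v) = word_eval a u * word_eval a v.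
Proof. by rewrite /word_eval big_cat. Qed.
Lemma word_eval_rcons w l : word_eval a (rcons w l) = word_eval a w * letter_eval l.
Proof. by rewrite -cats1 word_eval_cat word_eval_cons word_eval_nil mulg1. Qed.

Definition word_inv w : word n := rev [seq (l.1, ~~ l.2) | l <- w].

Lemma word_eval_inv w : word_eval a (word_inv w) = (word_eval a w)^-1.
Proof.
elim: w => [|[i b] w IH]; first by rewrite /word_inv /= word_eval_nil invg1.
rewrite /word_inv /= rev_cons word_eval_rcons IH word_eval_cons invgM.
by congr (_ * _); case: b; rewrite /letter_eval /= ?invgK.
Qed.

Lemma pres_eq_sound (r : seq (word n)) u v :
  (forall w, w \in r -> word_eval a w = 1) ->
  pres_eq r u v -> word_eval a u = word_eval a v.
Proof.
move=> ar; elim=> {u v} [//|u v _ ->//|u v w _ -> _ ->//|u v i b|u v w wr].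
  rewrite !word_eval_cat !word_eval_cons word_eval_nil.
  by case: b; rewrite /letter_eval /= mulg1 ?mulgV ?mulVg mul1g.
by rewrite !word_eval_cat (ar w)// mul1g.
Qed.
End WordEval.

Section PresentedGroup.
Local Open Scope group_scope.
Local Open Scope quotient_scope.
Variables (n : nat) (r : seq (word n)).
Implicit Types u v w : word n.

Lemma pres_eq_ctx x y u v : pres_eq r u v -> pres_eq r (x ++ u ++ y) (x ++ v ++ y).
Proof.
elim=> {u v} [*|u v _ IH|u v w _ IH _ IH'|u v i b|u v w wr].
- exact: pres_refl.
- exact: pres_sym.
- exact: pres_trans IH IH'.
- by have := pres_free r (x ++ u) (v ++ y) i b; rewrite -!catA.
- by have := @pres_rel _ r (x ++ u) (v ++ y) w wr; rewrite -!catA.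
Qed.

Lemma pres_eq_cat u u' v v' :
  pres_eq r u u' -> pres_eq r v v' -> pres_eq r (u ++ v) (u' ++ v').
Proof.
move=> /(@pres_eq_ctx [::] v) uu /(@pres_eq_ctx u' [::]); rewrite !cats0.
exact: pres_trans.
Qed.

Lemma pres_eq_mulV w : pres_eq r (w ++ word_inv w) [::].
Proof.
elim: w => [|[i b] w IH]; first exact: pres_refl.
rewrite /word_inv /= rev_cons -cats1 catA -cat1s.
apply: pres_trans (pres_free r [::] [::] i b).
by have := pres_eq_ctx [:: (i, b)] [:: (i, ~~ b)] IH.
Qed.

Lemma word_invK : involutive (@word_inv n).
Proof.
move=> w; rewrite /word_inv map_rev revK -map_comp -[RHS]map_id.
by apply: eq_map => -[i b] /=; rewrite negbK.
Qed.

Lemma pres_eq_Vmul w : pres_eq r (word_inv w ++ w) [::].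
Proof. by have := pres_eq_mulV (word_inv w); rewrite word_invK. Qed.

Definition pres_eqb u v := `[< pres_eq r u v >].
Lemma pres_eqb_refl : reflexive pres_eqb.
Proof. by move=> u; apply/asboolP; exact: pres_refl. Qed.
Lemma pres_eqb_sym : symmetric pres_eqb.
Proof. by move=> u v; apply/asboolP/asboolP; exact: pres_sym. Qed.
Lemma pres_eqb_trans : transitive pres_eqb.
Proof.
by move=> v u w /asboolP uv /asboolP vw; apply/asboolP; exact: pres_trans vw.
Qed.
Canonical pres_equiv := EquivRel pres_eqb pres_eqb_refl pres_eqb_sym pres_eqb_trans.

Definition presented : Type := {eq_quot pres_equiv}.
HB.instance Definition _ := Choice.on presented.
HB.instance Definition _ := Quotient.on presented.

Definition pres_class w : presented := \pi w.

Lemma pres_classP u v : pres_class u = pres_class v <-> pres_eq r u v.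
Proof. by split=> [/eqmodP/asboolP|uv] //; apply/eqmodP/asboolP. Qed.

Lemma repr_pres_class w : pres_eq r (repr (pres_class w)) w.
Proof. by apply/pres_classP; rewrite /pres_class reprK. Qed.

Definition pres_one := pres_class [::].
Definition pres_mul (x y : presented) := pres_class (repr x ++ repr y).
Definition pres_inv (x : presented) := pres_class (word_inv (repr x)).

Lemma pres_class_repr (x : presented) : pres_class (repr x) = x.
Proof. exact: reprK. Qed.

Lemma pres_mulE u v : pres_mul (pres_class u) (pres_class v) = pres_class (u ++ v).
Proof. by apply/pres_classP/pres_eq_cat; exact: repr_pres_class. Qed.

Lemma pres_mulA : associative pres_mul.
Proof.
move=> x y z; rewrite -[x]pres_class_repr -[y]pres_class_repr -[z]pres_class_repr.
by rewrite !pres_mulE catA.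
Qed.
Lemma pres_mul1 : left_id pres_one pres_mul.
Proof. by move=> x; rewrite -[x]pres_class_repr pres_mulE. Qed.
Lemma pres_mulr1 : right_id pres_one pres_mul.
Proof. by move=> x; rewrite -[x]pres_class_repr pres_mulE cats0. Qed.
Lemma pres_mulVx : left_inverse pres_one pres_inv pres_mul.
Proof.
move=> x; rewrite -{2}[x]pres_class_repr pres_mulE.
exact/pres_classP/pres_eq_Vmul.
Qed.
Lemma pres_mulxV : right_inverse pres_one pres_inv pres_mul.
Proof.
move=> x; rewrite -{1}[x]pres_class_repr pres_mulE.
exact/pres_classP/pres_eq_mulV.
Qed.

HB.instance Definition _ := isGroup.Build presented
  pres_mulA pres_mul1 pres_mulr1 pres_mulVx pres_mulxV.

Definition pres_gen i : presented := pres_class [:: (i, false)].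

Lemma word_eval_pres w : word_eval pres_gen w = pres_class w.
Proof.
elim: w => [|[i b] w IH]; first by rewrite word_eval_nil.
rewrite word_eval_cons IH -cat1s -[RHS]pres_mulE; congr (_ * _).
case: b => //; rewrite /letter_eval /=; apply: (mulgI (pres_gen i)).
rewrite mulgV [RHS]pres_mulE; symmetry; apply/pres_classP.
exact: (pres_free r [::] [::] i false).
Qed.
End PresentedGroup.

(** With the group presented by [r] as [H], a word trivial in [G] becomes derivable from [r].
    Completeness of the relators can thus be tested in groups rather than by derivations. *)
Lemma finitely_presented_crit (G : groupType) (n : nat) (a : 'I_n -> G)
    (r : seq (word n)) :
  generates a ->
  (forall w, w \in r -> word_eval a w = 1%g) ->
  (forall (H : groupType) (b : 'I_n -> H),
     (forall w, w \in r -> word_eval b w = 1%g) ->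
     forall u, word_eval a u = 1%g -> word_eval b u = 1%g) ->
  finitely_presented G.
Proof.
move=> gena ar univ; exists n, a, r; split=> // u v; split; last exact: pres_eq_sound.
move=> uv; apply/pres_classP; rewrite -!word_eval_pres.
have /univ h : forall w, w \in r -> word_eval (@pres_gen _ r) w = 1%g.
  move=> w wr; rewrite word_eval_pres; apply/pres_classP.
  by have := @pres_rel _ r [::] [::] w wr; rewrite cats0.
apply: divg1_eq; rewrite -word_eval_inv -word_eval_cat; apply: h.
by rewrite word_eval_cat word_eval_inv uv mulgV.
Qed.

(** * The infinite presentation *)

Section IteratedConjugation.
Local Open Scope group_scope.
Variables (G : groupType) (z : G).

Definition zconj j (g : G) : G := z ^+ j * g * z ^- j.

Lemma zconj0 g : zconj 0 g = g.
Proof. by rewrite /zconj expg0 invg1 mul1g mulg1. Qed.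
Lemma zconjM j g h : zconj j (g * h) = zconj j g * zconj j h.
Proof. by rewrite /zconj !mulgA mulgVK. Qed.
Lemma zconj_zconj j k g : zconj j (zconj k g) = zconj (j + k) g.
Proof. by rewrite /zconj expgnDr invgM !mulgA. Qed.
Lemma zconjS j g : z * zconj j g = zconj j.+1 g * z.
Proof. by rewrite /zconj expgS invgM !mulgA mulgVK. Qed.
Lemma zconj_commute j g h : commute g h -> commute (zconj j g) (zconj j h).
Proof. by move=> gh; rewrite /commute -!zconjM gh. Qed.

Section Translated.
Variable y : G.
Hypothesis y12 : y * zconj 1 y = zconj 2 y * y.

(** Write g_k = z^k g z^-k and likewise y_k. By strong induction, y g_(j+3) y_1 = y y_1 g_(j+2) =
    y_2 y g_(j+2) = y_2 g_(j+3) y = g_(j+4) y_2 y = g_(j+4) y y_1, so two instances imply all the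
    others. *)
Lemma translated_rel g :
  y * zconj 1 g = zconj 2 g * y -> y * zconj 2 g = zconj 3 g * y ->
  forall j, y * zconj j.+1 g = zconj j.+2 g * y.
Proof.
move=> g1 g2; elim/ltn_ind => -[//|[//|j]] IH.
have IH0 k : zconj k y * zconj (k + j.+1) g = zconj (k + j.+2) g * zconj k y.
  by rewrite -!(zconj_zconj k) -!zconjM IH.
apply: (mulIg (zconj 1 y)); rewrite -mulgA -(IH0 1%N) mulgA y12 -mulgA.
by rewrite IH// mulgA (IH0 2%N) -mulgA -y12 mulgA.
Qed.
End Translated.
End IteratedConjugation.

(* The two families of generators of the infinite presentation: [mx k] is the
   k-th Thompson generator and [mw j s] the s-th generator of the copy of the
   lamp group at the j-th point of an orbit on which [mx i] acts as [bump i]. *)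
Record model (n : nat) := Model {
  mgroup :> groupType;
  mx : nat -> mgroup;
  mw : nat -> 'I_n -> mgroup;
  mxx : forall k m, (k < m)%N -> (mx k * mx m = mx m.+1 * mx k)%g;
  mxw : forall i j s, (mx i * mw j s = mw (bump i j) s * mx i)%g;
  mww : forall j k s t, j != k -> commute (mw j s) (mw k t) }.
Arguments mx {n}.
Arguments mw {n}.

(** * From finitely many relations to the infinite presentation *)

Section FiniteRelations.
Local Open Scope group_scope.
Variables (n : nat) (G : groupType) (x0 x1 : G) (t : 'I_n -> G).

Definition xgen k := if k is k'.+1 then zconj x0 k' x1 else x0.
Definition wgen j s := zconj x0 j (t s).

(** The relations with x_0 hold because [xgen] and [wgen] are defined as conjugates. Each translated
    family starts from two instances, commutation of the x_i with w_0 starts from x_1 and x_2, and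
    commutation of lamps from one pair of neighbours. *)
Record finite_relations : Prop := FiniteRelations {
  fr12 : xgen 1 * xgen 2 = xgen 3 * xgen 1;
  fr13 : xgen 1 * xgen 3 = xgen 4 * xgen 1;
  frw10 : forall s, xgen 1 * wgen 0 s = wgen 0 s * xgen 1;
  frw20 : forall s, xgen 2 * wgen 0 s = wgen 0 s * xgen 2;
  frw11 : forall s, xgen 1 * wgen 1 s = wgen 2 s * xgen 1;
  frw12 : forall s, xgen 1 * wgen 2 s = wgen 3 s * xgen 1;
  frww : forall s s', wgen 0 s * wgen 1 s' = wgen 1 s' * wgen 0 s }.

Hypothesis fr : finite_relations.

Lemma xgen_rel j : x1 * zconj x0 j.+1 x1 = zconj x0 j.+2 x1 * x1.
Proof.
have [] := fr; rewrite /= zconj0 => r12 r13 _ _ _ _ _.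
exact: translated_rel.
Qed.

Lemma wgen_rel j s : x1 * wgen j.+1 s = wgen j.+2 s * x1.
Proof.
have [] := fr; rewrite /= zconj0 => r12 _ _ _ r1 r2 _.
exact: (translated_rel r12 (r1 s) (r2 s)).
Qed.

(** x_(i+3) is the conjugate of x_(i+2) by x_1, so commutation with w_0 spreads from x_1 and x_2. *)
Lemma xgenS_w0 i s : commute (xgen i.+1) (wgen 0 s).
Proof.
elim: i => [|[|i] IH]; [exact: frw10|exact: frw20|].
have -> : xgen i.+3 = x1 * xgen i.+2 * x1^-1 by rewrite /= xgen_rel mulgK.
have c1 : commute (wgen 0 s) x1.
  by have := frw10 fr s; rewrite /= zconj0 => /esym.
apply/commute_sym/commuteM; last exact: commuteV.
by apply: commuteM => //; exact: commute_sym.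
Qed.

(** w_(k+2) is the conjugate of w_(k+1) by x_1, which commutes with w_0. *)
Lemma w0_wS k s s' : commute (wgen 0 s) (wgen k.+1 s').
Proof.
elim: k => [|k IH]; first exact: frww.
have -> : wgen k.+2 s' = x1 * wgen k.+1 s' * x1^-1 by rewrite wgen_rel mulgK.
have c1 : commute (wgen 0 s) x1.
  by have := frw10 fr s; rewrite /= zconj0 => /esym.
apply: commuteM; last exact: commuteV.
exact: commuteM.
Qed.

Lemma wgen_shift j k s : wgen (j + k) s = zconj x0 j (wgen k s).
Proof. by rewrite /wgen zconj_zconj. Qed.

Lemma xgen_shift j k : xgen (j + k.+1) = zconj x0 j (xgen k.+1).
Proof. by rewrite addnS /= zconj_zconj. Qed.

Lemma xgen_xgen k m : (k < m)%N -> xgen k * xgen m = xgen m.+1 * xgen k.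
Proof.
case: k m => [|k] [|m] //; first by move=> _; exact: zconjS.
rewrite ltnS => /subnKC <-; set i := (m - k.+1)%N.
have -> : (k.+1 + i).+1 = (k + i.+2)%N by lia.
have -> : (k + i.+2).+1 = (k + i.+3)%N by lia.
have -> : k.+1 = (k + 1)%N by lia.
by rewrite !xgen_shift -!zconjM /= zconj0 xgen_rel.
Qed.

(** For positive i, conjugation by a power of x_0 reduces i <= j to x_1 against a later lamp, and j
    < i to w_0 against a later x. *)
Lemma xgen_wgen i j s : xgen i * wgen j s = wgen (bump i j) s * xgen i.
Proof.
case: i => [|i]; first exact: zconjS.
rewrite /bump; case: ltnP => [ij|ji].
  rewrite add1n -(subnKC ij); set m := (j - _)%N.
  have -> : (i.+1 + m)%N = (i + m.+1)%N by lia.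
  rewrite -addnS -addn1 xgen_shift !wgen_shift -!zconjM /= zconj0.
  by rewrite wgen_rel.
rewrite add0n -(subnKC ji) -addnS -[j in wgen j](addn0 j).
by rewrite xgen_shift wgen_shift -!zconjM xgenS_w0.
Qed.

Lemma wgen_wgen j k s s' : j != k -> commute (wgen j s) (wgen k s').
Proof.
suff H j' k' r r' : (j' < k')%N -> commute (wgen j' r) (wgen k' r').
  by case: ltngtP => // jk _; [exact: H|exact/commute_sym/H].
move=> jk; rewrite -[j'](addn0) -(subnKC jk) addSnnS !wgen_shift.
exact/zconj_commute/w0_wS.
Qed.

Definition model_of : model n := Model xgen_xgen xgen_wgen wgen_wgen.
End FiniteRelations.

(** * Normal forms of words, uniformly in the model *)

Section ModelWords.
Local Open Scope group_scope.
Variable n : nat.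
Implicit Types (M : model n) (p q : seq nat) (l : seq (nat * ('I_n * bool))).

Definition mX M p : M := \prod_(i <- p) mx M i.
Definition mD M l : M := \prod_(z <- l) letter_eval (mw M z.1) z.2.
Definition mgen M (i : 'I_(2 + n)) : M :=
  match fintype.split i with inl k => mx M k | inr s => mw M 0 s end.
Definition bumps p j := foldr bump j p.

Lemma mX_nil M : mX M [::] = 1. Proof. by rewrite /mX big_nil. Qed.
Lemma mX_cons M i p : mX M (i :: p) = mx M i * mX M p.
Proof. by rewrite /mX big_cons. Qed.
Lemma mX_rcons M i p : mX M (rcons p i) = mX M p * mx M i.
Proof. by rewrite /mX -cats1 big_cat big_seq1. Qed.
Lemma mD_cat M l l' : mD M (l ++ l') = mD M l * mD M l'.
Proof. by rewrite /mD big_cat. Qed.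
Lemma mD_cons M z l : mD M (z :: l) = letter_eval (mw M z.1) z.2 * mD M l.
Proof. by rewrite /mD big_cons. Qed.

Lemma mxl M i j c :
  mx M i * letter_eval (mw M j) c = letter_eval (mw M (bump i j)) c * mx M i.
Proof.
case: c => s [] /=; rewrite /letter_eval /= ?mxw//.
apply: (mulIg (mw M j s)); rewrite mulgVK -mulgA mxw mulgA mulVg.
by rewrite mul1g.
Qed.

Lemma mXl M p j c :
  mX M p * letter_eval (mw M j) c = letter_eval (mw M (bumps p j)) c * mX M p.
Proof.
elim: p => [|i p IH]; first by rewrite mX_nil mul1g mulg1.
by rewrite mX_cons -mulgA IH mulgA mxl mulgA.
Qed.

Lemma mx_mD M i l :
  mx M i * mD M l = mD M [seq (bump i z.1, z.2) | z <- l] * mx M i.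
Proof.
elim: l => [|z l IH]; first by rewrite /mD /= !big_nil mul1g mulg1.
by rewrite /= !mD_cons /= mulgA mxl -mulgA IH mulgA.
Qed.

(** The inverse letter moves left through [p] by x_k x_j^-1 = x_(j+1)^-1 x_k for k < j and x_k
    x_j^-1 = x_j^-1 x_(k+1) for j < k, or cancels, so at most one inverse letter survives. *)
Lemma mX_mxV p i : exists q p', (size q <= 1)%N /\
  forall M, mX M p * (mx M i)^-1 = (mX M q)^-1 * mX M p'.
Proof.
elim: p => [|k p [q [p' [q1 H]]]]; last case: q q1 H => [|j [|//]] _ H.
- exists [:: i], [::]; split=> // M.
  by rewrite mX_cons mX_nil mulg1 mul1g mulg1.
- exists [::], (k :: p'); split=> // M.
  by rewrite mX_cons -mulgA H mX_cons !mX_nil invg1 !mul1g.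
have [kj|jk|kj] := ltngtP k j.
- exists [:: j.+1], (k :: p'); split=> // M; rewrite mX_cons -mulgA H !mX_cons mX_nil !mulg1.
  rewrite !mulgA; congr (_ * _); apply: (mulIg (mx M j)); rewrite mulgVK.
  by apply: (mulgI (mx M j.+1)); rewrite -!mulgA mulVKg (mxx M kj).
- exists [:: j], (k.+1 :: p'); split=> // M; rewrite mX_cons -mulgA H !mX_cons mX_nil !mulg1.
  rewrite !mulgA; congr (_ * _); apply: (mulIg (mx M j)); rewrite mulgVK.
  by apply: (mulgI (mx M j)); rewrite -!mulgA mulVKg (mxx M jk).
- exists [::], p'; split=> // M; subst k.
  by rewrite mX_cons -mulgA H !mX_cons mX_nil mulg1 invg1 mul1g mulVKg.
Qed.

Lemma mgen_lshift M (k : 'I_2) : mgen M (lshift n k) = mx M k.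
Proof. by rewrite /mgen -[lshift n k]/(unsplit (inl k)) unsplitK. Qed.
Lemma mgen_rshift M s : mgen M (rshift 2 s) = mw M 0 s.
Proof. by rewrite /mgen -[rshift 2 s]/(unsplit (inr s)) unsplitK. Qed.

(** One form serves all models, so that facts read off in the wreath product carry over to other
    groups. A new last letter is absorbed as follows: a lamp moves left past [p], x_k joins [p], and
    x_k^-1 crosses [p] and then the lamps, bumping their indices. *)
Lemma model_normal_form (u : word (2 + n)) : exists q l p,
  forall M, word_eval (mgen M) u = (mX M q)^-1 * mD M l * mX M p.
Proof.
elim/last_ind: u => [|u [i b] [q [l [p H]]]].
  exists [::], [::], [::] => M.
  by rewrite word_eval_nil /mX /mD !big_nil invg1 !mulg1.
rewrite -(splitK i); case: (fintype.split i) => [k|s]; last first.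
  exists q, (rcons l (bumps p 0, (s, b))), p => M.
  rewrite word_eval_rcons H -cats1 mD_cat mD_cons /= {3}/mD big_nil mulg1.
  rewrite -!mulgA -mXl; congr (_ * (_ * (_ * _))).
  by rewrite /letter_eval /= ?mgen_rshift ?mgen_lshift.
case: b; last first.
  exists q, l, (rcons p k) => M; rewrite word_eval_rcons H mX_rcons mulgA.
  by rewrite /letter_eval /= ?mgen_rshift ?mgen_lshift.
have [q' [p' [q1 H']]] := mX_mxV p k; case: q' q1 H' => [|j [|//]] _ H'.
  exists q, l, p' => M; rewrite word_eval_rcons H /letter_eval /= ?mgen_rshift ?mgen_lshift.
  by rewrite -mulgA H' mX_nil invg1 mul1g.
exists (j :: q), [seq (bump j z.1, z.2) | z <- l], p' => M.
rewrite word_eval_rcons H /letter_eval /= ?mgen_rshift ?mgen_lshift.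
rewrite -mulgA H' (mX_cons M j q) mX_cons mX_nil mulg1 invgM !mulgA.
congr (_ * _); rewrite -!mulgA; congr (_ * _); apply: (mulIg (mx M j)).
by rewrite mulgVK -mulgA -mx_mD mulKg.
Qed.

(* Moves [x_i] into a non-increasing word by [x_i x_k = x_(k+1) x_i], [i < k]. *)
Fixpoint insert_bump i p :=
  if p is k :: p' then if (k <= i)%N then i :: p else k.+1 :: insert_bump i p'
  else [:: i].

Lemma mX_insert M i p : mX M (insert_bump i p) = mx M i * mX M p.
Proof.
elim: p => [|k p IH] /=; first by rewrite mX_cons.
case: leqP => [ki|ik]; first by rewrite mX_cons.
by rewrite !mX_cons IH !mulgA (mxx M ik).
Qed.

Lemma sorted_insert i p : sorted geq p -> sorted geq (insert_bump i p).
Proof.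
have geq_trans : transitive geq by move=> a b c; rewrite /= => ba /leq_trans; apply.
elim: p => //= k p IH; rewrite path_sortedE// => /andP[kp sp].
case: leqP => [ki|ik] /=; first by rewrite ki path_sortedE// kp.
rewrite path_sortedE// IH// andbT.
elim: p kp {IH sp} => [|m p IH] /=; first by rewrite andbT ltnW// ltnW.
case/andP=> mk kp; case: leqP => mi /=.
  rewrite (leqW (ltnW ik)) (leqW mk) /=.
  by apply: sub_all kp => x; exact: leqW.
by rewrite ltnS mk IH.
Qed.

Lemma mX_sort p : exists2 p', sorted geq p' & forall M, mX M p = mX M p'.
Proof.
elim: p => [|i p [p' sp H]]; first by exists [::].
exists (insert_bump i p') => [|M]; first exact: sorted_insert.
by rewrite mX_insert mX_cons H.
Qed.

Lemma bumps_ge p j : (j <= bumps p j)%N.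
Proof. by elim: p => //= i p IH; rewrite /bump; lia. Qed.

Lemma bumps_fix p j : all (fun i => j < i)%N p -> bumps p j = j.
Proof. by elim: p => //= i p IH /andP[ji /IH->]; rewrite /bump leqNgt ji. Qed.

Lemma bumps_rcons p i j : bumps (rcons p i) j = bumps p (bump i j).
Proof. by rewrite /bumps foldr_rcons. Qed.

Section Faithful.
Variable M0 : model n.
Hypothesis M0_bumps : forall p q, mX M0 p = mX M0 q -> bumps p =1 bumps q.

(** The last letter of a non-increasing word is its smallest, and is also the smallest index moved
    by [bumps]. Equal elements therefore share it, and it cancels. *)
Lemma mX_sorted_inj p q : sorted geq p -> sorted geq q ->
  mX M0 p = mX M0 q -> p = q.
Proof.
have geq_trans : transitive geq by move=> a b c; rewrite /= => ba /leq_trans; apply.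
have rsort r i : sorted geq (rcons r i) -> all (fun k => i <= k)%N r /\ sorted geq r.
  move=> s; split; last first.
    by move: s; rewrite -cats1; apply: (subseq_sorted geq_trans); exact: prefix_subseq.
  move: s; rewrite -rev_sorted rev_rcons /= path_sortedE 1?all_rev => [/andP[]//|].
  by move=> b a c /=; exact: leq_trans.
have bad p' i q' : all (fun k => i < k)%N q' -> mX M0 (rcons p' i) <> mX M0 q'.
  move=> iq /M0_bumps/(_ i); rewrite bumps_rcons (bumps_fix iq) /bump leqnn add1n => E.
  by have := bumps_ge p' i.+1; rewrite E ltnn.
elim/last_ind: p q => [|p i IH] q.
  elim/last_ind: q => [//|q j _] _ _ /esym E; exfalso.
  exact: (bad q j [::]) E.
elim/last_ind: q => [|q j _] sp sq E; first by exfalso; exact: (bad p i [::]) E.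
have [[pi sp'] [qj sq']] := (rsort _ _ sp, rsort _ _ sq).
have [ij|ji|ij] := ltngtP i j.
- exfalso; apply: (bad p i) E; rewrite all_rcons ij.
  by apply: sub_all qj => x; exact: leq_trans.
- exfalso; apply: (bad q j) (esym E); rewrite all_rcons ji.
  by apply: sub_all pi => x; exact: leq_trans.
move: E; rewrite !mX_rcons ij => /mulIg E.
by congr rcons; exact: IH.
Qed.

(** In every model a positive word equals its sorted form, and equality in [M0] identifies the
    sorted forms. *)
Lemma mX_inj M p q : mX M0 p = mX M0 q -> mX M p = mX M q.
Proof.
have [p' sp Hp] := mX_sort p; have [q' sq Hq] := mX_sort q.
by rewrite !Hp !Hq => /mX_sorted_inj->.
Qed.
End Faithful.

Definition collect l j : word n := [seq z.2 | z <- l & z.1 == j].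

(** Lamps at different indices commute, so the product can be grouped by index while keeping the
    order inside each group. *)
Lemma mD_collect M l m : all (fun z => z.1 < m)%N l ->
  mD M l = \prod_(j < m) word_eval (mw M j) (collect l j).
Proof.
move=> lm.
have comm j k c w : j != k ->
    commute (letter_eval (mw M k) c) (word_eval (mw M j) w).
  move=> jk; apply: commute_prod => -[s' b'] _; case: c => s b.
  have c : commute (mw M k s) (mw M j s') by apply: mww; rewrite eq_sym.
  rewrite /letter_eval /=; case: b; case: b' => //=.
  - by apply/commuteV/commute_sym/commuteV/commute_sym.
  - by apply/commute_sym/commuteV/commute_sym.
  - exact: commuteV.
elim: l lm => [|[k c] l IH] /=.
  move=> _; rewrite /mD big_nil big1// => j _; exact: word_eval_nil.
case/andP=> /= km /IH {}IH; rewrite mD_cons IH /= {IH}.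
elim: m km => // m IH; rewrite ltnS leq_eqVlt => /orP[/eqP<-|km].
  rewrite !big_ord_recr /= mulgA.
  have -> : letter_eval (mw M k) c * \prod_(i < k) word_eval (mw M i) (collect l i)
    = \prod_(i < k) word_eval (mw M i) (collect l i) * letter_eval (mw M k) c.
    apply: commute_prod => j _; apply: comm.
    by rewrite neq_ltn ltn_ord.
  rewrite -mulgA; congr (_ * _).
    by apply: eq_bigr => j _; rewrite /collect /= gtn_eqF.
  by rewrite /collect /= eqxx /= word_eval_cons.
by rewrite !big_ord_recr /= mulgA IH// /collect /= (ltn_eqF km).
Qed.

Lemma mD1 M l : (forall j, word_eval (mw M j) (collect l j) = 1) -> mD M l = 1.
Proof.
move=> H; rewrite (@mD_collect M l (\max_(z <- l) z.1).+1).
  by rewrite big1// => j _; exact: H.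
by apply/allP => z zl; rewrite ltnS (leq_bigmax_seq z).
Qed.

(** If the normal form q^-1 d p is trivial in [M0], then d p = q there. The hypotheses give d = 1 in
    [M] and p = q in [M0], and the latter passes to [M] through sorted forms. *)
Lemma model_kernel M0 M :
  (forall p q, mX M0 p = mX M0 q -> bumps p =1 bumps q) ->
  (forall p q l, mD M0 l * mX M0 p = mX M0 q -> mX M0 p = mX M0 q /\
     forall j, word_eval (mw M j) (collect l j) = 1) ->
  forall u, word_eval (mgen M0) u = 1 -> word_eval (mgen M) u = 1.
Proof.
move=> faith ker u; have [q [l [p H]]] := model_normal_form u.
rewrite !H -mulgA => /(canRL (mulVKg _)); rewrite mulg1 => /ker[E D1].
by rewrite mD1// mulg1 (mX_inj faith _ E) mulVg.
Qed.
End ModelWords.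

(** * Thompson's group *)

Section Evaluation.
Local Open Scope ring_scope.
Variable R : realType.
Implicit Types (x y c : R) (f g : thompsonF R).
Local Notation I01 := (set_type (@unit_interval R)).

Definition to01 x : I01 := insubd (pt0 R) x.

Lemma to01K x : 0 <= x <= 1 -> val (to01 x) = x.
Proof. by move=> x01; rewrite val_insubd ifT//; exact/mem_set. Qed.
Lemma val01K : cancel val to01.
Proof. by move=> z; rewrite /to01 valKd. Qed.
Lemma val01 (z : I01) : 0 <= val z <= 1.
Proof. by rewrite I01_ge0 I01_le1. Qed.

(* Junk value: outside [0, 1] this is [f 0 = 0]. *)
Definition ev f x : R := val (val f (to01 x)).

Lemma ev_val f (z : I01) : ev f (val z) = val (val f z).
Proof. by rewrite /ev val01K. Qed.
Lemma ev01 f x : 0 <= ev f x <= 1.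
Proof. exact: val01. Qed.
Lemma evM f g x : ev (f * g)%g x = ev f (ev g x).
Proof. by rewrite /ev val01K. Qed.
Lemma ev_id x : 0 <= x <= 1 -> ev 1%g x = x.
Proof. by move=> x01; rewrite /ev /= to01K. Qed.
Lemma ev_ext f g : (forall x, 0 <= x <= 1 -> ev f x = ev g x) -> f = g.
Proof.
move=> fg; apply: val_inj; apply/funext => z; apply: val_inj.
by rewrite -!ev_val fg// val01.
Qed.
Lemma ev_lt f x y : 0 <= x <= 1 -> 0 <= y <= 1 -> (ev f x < ev f y) = (x < y).
Proof.
move=> x01 y01; have [_ inc _] := thompsonP f.
by rewrite (increasing_lt inc) !to01K.
Qed.
Lemma ev_0 f : ev f 0 = 0.
Proof. by rewrite -[0 in LHS]/(val (pt0 R)) ev_val (thompson_pt0 (thompsonP f)). Qed.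
Lemma ev_1 f : ev f 1 = 1.
Proof. by rewrite -[1 in LHS]/(val (pt1 R)) ev_val (thompson_pt1 (thompsonP f)). Qed.
Lemma ev_dyadic f x : dyadic x -> dyadic (ev f x).
Proof.
move=> dx; apply: thompson_dyadic; first exact: thompsonP.
rewrite val_insubd; case: ifP => // _; exact: dyadic0.
Qed.

Section Bump.
Variable c : R.
Hypotheses (c01 : 0 <= c < 1) (dc : dyadic c).

(* The slopes on [c, 1] are 2, 1 and 1/2; the min-max form makes continuity
   immediate. *)
Definition stretch x :=
  Num.max x (Num.min (2 * x - c) (Num.min (x + (1 - c) / 4) ((x + 1) / 2))).
Definition unstretch y :=
  Num.min y (Num.max ((y + c) / 2) (Num.max (y - (1 - c) / 4) (2 * y - 1))).

Lemma stretchE x : stretch x =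
  if x <= c then x else if x <= c + (1 - c) / 4 then 2 * x - c
  else if x <= c + (1 - c) / 2 then x + (1 - c) / 4 else
  if x <= 1 then (x + 1) / 2 else x.
Proof.
have /andP[c0 c1] := c01; rewrite /stretch !(maxEle, minEle).
by repeat case: ifP => // /idP; lra.
Qed.

Lemma unstretchE y : unstretch y =
  if y <= c then y else if y <= c + (1 - c) / 2 then (y + c) / 2
  else if y <= c + 3 * (1 - c) / 4 then y - (1 - c) / 4 else
  if y <= 1 then 2 * y - 1 else y.
Proof.
have /andP[c0 c1] := c01; rewrite /unstretch !(maxEle, minEle).
by repeat case: ifP => // /idP; lra.
Qed.

Lemma stretchK : cancel stretch unstretch.
Proof.
have /andP[c0 c1] := c01; move=> x; rewrite stretchE unstretchE.
by repeat case: ifP => // /idP; lra.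
Qed.
Lemma unstretchK : cancel unstretch stretch.
Proof.
have /andP[c0 c1] := c01; move=> x; rewrite unstretchE stretchE.
by repeat case: ifP => // /idP; lra.
Qed.

Lemma stretch_lt x y : x < y -> stretch x < stretch y.
Proof.
have /andP[c0 c1] := c01; rewrite !stretchE.
by repeat case: ifP => // /idP; lra.
Qed.

Lemma stretch01 x : (0 <= stretch x <= 1) = (0 <= x <= 1).
Proof.
have /andP[c0 c1] := c01; rewrite stretchE.
by repeat case: ifP => // /idP; lra.
Qed.

Lemma unstretch01 x : (0 <= unstretch x <= 1) = (0 <= x <= 1).
Proof. by rewrite -stretch01 unstretchK. Qed.

Lemma stretch_continuous : continuous stretch.
Proof.
have lin (a b : R) : continuous (fun x => a * x + b : R^o).
  by move=> x; apply: cvgD; [apply: cvgMr; exact: cvg_id|exact: cvg_cst].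
have st : stretch = (fun x => 1 * x + 0) \max ((fun x => 2 * x + - c) \min
    ((fun x => 1 * x + (1 - c) / 4) \min (fun x => 2^-1 * x + 2^-1))).
  apply/funext => x; rewrite /stretch /= mul1r addr0; congr (Num.max _ (Num.min _ (Num.min _ _))).
  by rewrite mulrDl mul1r mulrC.
rewrite st => x; apply: continuous_max; first exact: lin.
by apply: continuous_min; [exact: lin|apply: continuous_min; exact: lin].
Qed.

Lemma unstretch_continuous : continuous unstretch.
Proof.
have lin (a b : R) : continuous (fun x => a * x + b : R^o).
  by move=> x; apply: cvgD; [apply: cvgMr; exact: cvg_id|exact: cvg_cst].
have st : unstretch = (fun x => 1 * x + 0) \min ((fun x => 2^-1 * x + c / 2) \max
    ((fun x => 1 * x + - ((1 - c) / 4)) \max (fun x => 2 * x + - 1))).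
  apply/funext => x; rewrite /unstretch /= mul1r addr0; congr (Num.min _ (Num.max _ (Num.max _ _))).
  by rewrite mulrDl [in RHS]mulrC.
rewrite st => x; apply: continuous_min; first exact: lin.
by apply: continuous_max; [exact: lin|apply: continuous_max; exact: lin].
Qed.

Definition lift01 (F : R -> R) (z : I01) : I01 := to01 (F (val z)).

Lemma val_lift01 (F : R -> R) z : (forall x, 0 <= x <= 1 -> 0 <= F x <= 1) ->
  val (lift01 F z) = F (val z).
Proof. by move=> F01; rewrite to01K// F01// val01. Qed.

Lemma lift01_continuous (F : R -> R) : (forall x, 0 <= x <= 1 -> 0 <= F x <= 1) ->
  continuous F -> continuous (lift01 F).
Proof.
move=> F01 cF; apply: continuous_comp_initial.
have -> : set_val \o lift01 F = F \o set_val by apply/funext => z; exact: val_lift01.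
by move=> z; apply: continuous_comp; [exact: initial_continuous|exact: cF].
Qed.

Lemma stretch_thompson : is_thompson (lift01 stretch).
Proof.
have /andP[c0 c1] := c01.
have s01 x : 0 <= x <= 1 -> 0 <= stretch x <= 1 by rewrite stretch01.
have u01 x : 0 <= x <= 1 -> 0 <= unstretch x <= 1 by rewrite unstretch01.
have d4 : dyadic ((1 - c) / 4).
  have -> : (1 - c) / 4 = 2 ^ (- 2%:Z) * (1 + - c).
    by rewrite -exprnN -natrX mulrC.
  apply: dyadicZ; apply: dyadicD; last exact: dyadicN.
  by exists 1, 0%N; rewrite expr0 divr1.
split.
- exists (lift01 unstretch); split.
  + exact: lift01_continuous stretch_continuous.
  + exact: lift01_continuous unstretch_continuous.
  + by move=> z; apply: val_inj; rewrite !val_lift01// stretchK.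
  + by move=> z; apply: val_inj; rewrite !val_lift01// unstretchK.
- by move=> z t zt; rewrite !val_lift01//; exact: stretch_lt.
(* The breakpoints of [stretch] below 1; the last is c + (1 - c) / 2, written as a sum of dyadic
   numbers. *)
exists (map to01 [:: c; c + (1 - c) / 4; c + (1 - c) / 4 + (1 - c) / 4]); split.
  move=> t /mapP[u us ->]; rewrite to01K.
    move: us; rewrite !inE => /or3P[] /eqP-> //.
      exact: dyadicD.
    by apply: dyadicD => //; exact: dyadicD.
  by move: us; rewrite !inE => /or3P[] /eqP->; lra.
move=> a b ab nab.
(* No breakpoint lies strictly between [a] and [b], so the segment is on one side of each and inside
   a single affine piece. *)
have sep u : u \in [:: c; c + (1 - c) / 4; c + (1 - c) / 4 + (1 - c) / 4] ->
    val b <= u \/ u <= val a.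
  move=> us; have := nab _ (map_f to01 us).
  rewrite to01K; last by move: us; rewrite !inE => /or3P[] /eqP->; lra.
  by rewrite negb_and -!leNgt => /orP[]; [right|left].
have [b1|a1] := sep c (mem_head _ _).
  exists 0, 0 => x xab; rewrite val_lift01// stretchE expr0z mul1r addr0.
  by rewrite ifT//; lra.
have [b2|a2] : val b <= c + (1 - c) / 4 \/ c + (1 - c) / 4 <= val a.
  by apply: sep; rewrite !inE eqxx orbT.
  exists 1, (- c) => x xab; rewrite val_lift01// stretchE expr1z.
  by repeat case: ifP => // /idP; lra.
have [b3|a3] : val b <= c + (1 - c) / 4 + (1 - c) / 4 \/
    c + (1 - c) / 4 + (1 - c) / 4 <= val a.
  by apply: sep; rewrite !inE eqxx !orbT.
  exists 0, ((1 - c) / 4) => x xab; rewrite val_lift01// stretchE expr0z mul1r.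
  by repeat case: ifP => // /idP; lra.
exists (-1), (1 / 2) => x xab; rewrite val_lift01// stretchE.
have /andP[x0 x1] := val01 x; rewrite exprN1.
by repeat case: ifP => // /idP; lra.
Qed.

Definition stretchF : thompsonF R := F_of stretch_thompson.

Lemma ev_stretchF x : 0 <= x <= 1 -> ev stretchF x = stretch x.
Proof.
by move=> x01; rewrite /ev /= val_lift01 ?to01K// => y; rewrite stretch01.
Qed.
End Bump.
End Evaluation.

(** * The generators x_n and the points c_n *)

Section ThompsonGenerators.
Local Open Scope ring_scope.
Variable R : realType.
Implicit Types (x y u v : R) (f g : thompsonF R) (p q : seq nat).

Definition cpt n : R := 1 - 2 ^- n.

Lemma cpt0 : cpt 0 = 0.
Proof. by rewrite /cpt expr0 invr1 subrr. Qed.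
Lemma cptS n : cpt n.+1 = (cpt n + 1) / 2.
Proof. by rewrite /cpt exprS invfM; lra. Qed.
Lemma cpt01 n : 0 <= cpt n < 1.
Proof. by elim: n => [|n IH]; rewrite ?cpt0 ?cptS; lra. Qed.
Lemma cpt01W n : 0 <= cpt n <= 1.
Proof. by have := cpt01 n; lra. Qed.
Lemma cpt_lt i j : (i < j)%N -> cpt i < cpt j.
Proof.
elim: j => // j IH; rewrite ltnS leq_eqVlt cptS => /orP[/eqP->|/IH];
  have := cpt01 j; lra.
Qed.
Lemma cpt_inj : injective cpt.
Proof.
move=> i j E; have [/cpt_lt|/cpt_lt|//] := ltngtP i j; by rewrite E ltxx.
Qed.
Lemma cpt_dyadic n : dyadic (cpt n).
Proof.
apply: dyadicD; first by exists 1, 0%N; rewrite expr0 divr1.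
by apply: dyadicN; exists 1, n; rewrite mul1r.
Qed.

Definition xF n : thompsonF R := stretchF (cpt01 n) (cpt_dyadic n).
Definition XF p : thompsonF R := (\prod_(i <- p) xF i)%g.

Lemma XF_cons i p : XF (i :: p) = (xF i * XF p)%g.
Proof. by rewrite /XF big_cons. Qed.

Lemma ev_xF n x : 0 <= x <= 1 -> ev (xF n) x = stretch (cpt n) x.
Proof. exact: ev_stretchF. Qed.

Lemma stretch_id c x : 0 <= c < 1 -> x <= c -> stretch c x = x.
Proof. by move=> c01 xc; rewrite (stretchE c01) xc. Qed.
Lemma stretch_2 c x : 0 <= c < 1 -> c <= x <= c + (1 - c) / 4 ->
  stretch c x = 2 * x - c.
Proof.
by move=> c01 xc; rewrite (stretchE c01); repeat case: ifP => // /idP; lra.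
Qed.
Lemma stretch_1 c x : 0 <= c < 1 -> c + (1 - c) / 4 <= x <= c + (1 - c) / 2 ->
  stretch c x = x + (1 - c) / 4.
Proof.
by move=> c01 xc; rewrite (stretchE c01); repeat case: ifP => // /idP; lra.
Qed.
Lemma stretch_half c x : 0 <= c < 1 -> c + (1 - c) / 2 <= x <= 1 ->
  stretch c x = (x + 1) / 2.
Proof.
by move=> c01 xc; rewrite (stretchE c01); repeat case: ifP => // /idP; lra.
Qed.

Lemma stretch_le1 c x : 0 <= c < 1 -> x <= 1 -> x <= stretch c x <= 1.
Proof.
by move=> c01 x1; rewrite (stretchE c01); repeat case: ifP => // /idP; lra.
Qed.

(** Up to c_m both sides equal x_k, whose values there are at most c_(m+1). From c_m on, x_k is t ->
    (t + 1) / 2 because c_(k+1) <= c_m, and this map conjugates x_m to x_(m+1). *)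
Lemma xF_rel k m : (k < m)%N -> (xF k * xF m = xF m.+1 * xF k)%g.
Proof.
move=> km; apply: ev_ext => x x01; rewrite !evM !ev_xF ?stretch01 ?cpt01//.
have ck := cpt01 k; have cm := cpt01 m; have cm1 := cpt01 m.+1.
have kS : cpt k + (1 - cpt k) / 2 <= cpt m.
  have -> : cpt k + (1 - cpt k) / 2 = cpt k.+1 by rewrite cptS; lra.
  by move: km; rewrite leq_eqVlt => /orP[/eqP->//|/cpt_lt/ltW].
have [xm|/ltW mx] := leP x (cpt m).
  rewrite (stretch_id cm)// (stretch_id cm1)//.
  have [->|/negPf xm'] := eqVneq x (cpt m).
    by rewrite cptS (stretch_half ck); lra.
  apply: (@le_trans _ _ (stretch (cpt k) (cpt m))).
    by apply/ltW/stretch_lt => //; rewrite lt_neqAle xm' xm.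
  by rewrite cptS (stretch_half ck); lra.
have x1 : x <= 1 by lra.
have := stretch_le1 cm x1 => ?.
rewrite (@stretch_half (cpt k) (stretch (cpt m) x)) 1?(@stretch_half (cpt k) x)//; [|lra..].
rewrite !stretchE// cptS.
by repeat case: ifP => // /idP; lra.
Qed.

Lemma xF_cpt i j : ev (xF i) (cpt j) = cpt (if (j <= i)%N then j else j.+1).
Proof.
rewrite ev_xF ?cpt01W//; have ci := cpt01 i.
case: leqP => [|ij].
  rewrite leq_eqVlt => /orP[/eqP->|/cpt_lt/ltW ji]; exact: stretch_id.
rewrite [RHS]cptS stretch_half//.
have -> : cpt i + (1 - cpt i) / 2 = cpt i.+1 by rewrite cptS; lra.
have /andP[_ /ltW ->] := cpt01 j; rewrite andbT.
by move: ij; rewrite leq_eqVlt => /orP[/eqP->//|/cpt_lt/ltW].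
Qed.

(** The shift by one leaves out c_0 = 0, which lies outside the open interval: the j-th point of the
    orbit is c_(j+1). *)
Lemma XF_cpt p j : ev (XF p) (cpt j.+1) = cpt (bumps p j).+1.
Proof.
elim: p => [|i p IH]; first by rewrite /XF big_nil ev_id ?cpt01W.
rewrite XF_cons evM IH xF_cpt /= /bump; congr cpt.
by case: (ltnP (bumps p j) i).
Qed.

(** Parametrised by [s] in [0, 1] rather than by a slope, so that composites and halves need no
    slope computation. *)
Definition affine_on f u v u' v' := forall s, 0 <= s <= 1 ->
  ev f (u + s * (v - u)) = u' + s * (v' - u').

Lemma affine_comp f g u v u' v' u'' v'' :
  affine_on f u v u' v' -> affine_on g u' v' u'' v'' ->
  affine_on (g * f)%g u v u'' v''.
Proof. by move=> Af Ag s s01; rewrite evM Af// Ag. Qed.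

Lemma affine_left f u v u' v' : affine_on f u v u' v' ->
  affine_on f u ((u + v) / 2) u' ((u' + v') / 2).
Proof.
move=> Af s s01.
have -> : u + s * ((u + v) / 2 - u) = u + (s / 2) * (v - u) by field.
by rewrite Af; [field|lra].
Qed.

Lemma affine_right f u v u' v' : affine_on f u v u' v' ->
  affine_on f ((u + v) / 2) v ((u' + v') / 2) v'.
Proof.
move=> Af s s01.
have -> : (u + v) / 2 + s * (v - (u + v) / 2) = u + ((s + 1) / 2) * (v - u) by field.
by rewrite Af; [field|lra].
Qed.

Lemma affineP A B f u v u' v' : u <= v -> u' = A * u + B -> v' = A * v + B ->
  (forall x, u <= x <= v -> ev f x = A * x + B) -> affine_on f u v u' v'.
Proof.
move=> uv -> -> Af s /andP[s0 s1]; rewrite Af; first ring.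
have := mulr_ge0 s0 (_ : 0 <= v - u).
have := mulr_ge0 (_ : 0 <= 1 - s) (_ : 0 <= v - u).
by rewrite !subr_ge0 => /(_ s1 uv) h1 /(_ uv) h2; apply/andP; split; lra.
Qed.

Lemma affine_id u v : 0 <= u -> u <= v -> v <= 1 -> affine_on 1%g u v u v.
Proof.
move=> u0 uv v1; apply: (affineP (A := 1) (B := 0)); rewrite ?mul1r ?addr0//.
by move=> x xuv; rewrite ev_id ?mul1r ?addr0//; lra.
Qed.

Lemma affine_l f u v u' v' : affine_on f u v u' v' -> ev f u = u'.
Proof. by move=> /(_ 0); rewrite !mul0r !addr0; apply; rewrite lexx ler01. Qed.
Lemma affine_r f u v u' v' : affine_on f u v u' v' -> ev f v = v'.
Proof.
by move=> /(_ 1); rewrite !mul1r !(addrC _ (_ - _)) !subrK; apply; rewrite lexx ler01.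
Qed.

Lemma affine_eq f g u v u' v' : affine_on f u v u' v' -> affine_on g u v u' v' ->
  forall x, u <= x <= v -> ev f x = ev g x.
Proof.
move=> Af Ag x /andP[ux xv]; have [uv|] := ltP u v; last first.
  move=> vu; have -> : x = u by apply/eqP; rewrite eq_le ux (le_trans xv vu).
  by rewrite (affine_l Af) (affine_l Ag).
have -> : x = u + ((x - u) / (v - u)) * (v - u) by field; rewrite subr_eq0 gt_eqF.
have h : 0 <= (x - u) / (v - u) <= 1.
  apply/andP; split; first by rewrite divr_ge0// subr_ge0// ltW.
  by rewrite ler_pdivrMr ?subr_gt0// mul1r lerB.
by rewrite Af ?Ag.
Qed.

(* The partition of [0, 1] cut out by [cpt 0, ..., cpt N] and [1]. *)
Definition ladder N j := if (j <= N)%N then cpt j else 1.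

Lemma ladderS N j : (j <= N)%N -> ladder N j <= ladder N j.+1.
Proof.
move=> jN; rewrite /ladder jN; case: ifP => _; last by have := cpt01 j; lra.
exact/ltW/cpt_lt.
Qed.

Lemma xF_below i u v : 0 <= u -> u <= v -> v <= cpt i -> affine_on (xF i) u v u v.
Proof.
move=> u0 uv vi; apply: (affineP (A := 1) (B := 0)); rewrite ?mul1r ?addr0//.
have := cpt01 i => ci x xuv.
by rewrite ev_xF ?stretch_id//; lra.
Qed.

(** With [xF_right]: x_i carries the two halves of [c_i, c_(i+1)] to [c_i, c_(i+1)] and
    [c_(i+1), c_(i+2)], which undoes the merging of two siblings. *)
Lemma xF_left i :
  affine_on (xF i) (cpt i) ((cpt i + cpt i.+1) / 2) (cpt i) (cpt i.+1).
Proof.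
have ci := cpt01 i; apply: (affineP (A := 2) (B := - cpt i)); rewrite ?cptS; try lra.
by move=> x xuv; rewrite ev_xF ?stretch_2//; lra.
Qed.

Lemma xF_right i :
  affine_on (xF i) ((cpt i + cpt i.+1) / 2) (cpt i.+1) (cpt i.+1) (cpt i.+2).
Proof.
have ci := cpt01 i; apply: (affineP (A := 1) (B := (1 - cpt i) / 4)); rewrite ?cptS; try lra.
by move=> x xuv; rewrite ev_xF ?stretch_1//; lra.
Qed.

Lemma xF_above i u v : cpt i.+1 <= u -> u <= v -> v <= 1 ->
  affine_on (xF i) u v ((u + 1) / 2) ((v + 1) / 2).
Proof.
move=> iu uv v1; apply: (affineP (A := 2^-1) (B := 2^-1)) => //; try lra.
have ci := cpt01 i; move: iu; rewrite cptS => iu x xuv.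
rewrite ev_xF ?stretch_half//; lra.
Qed.
End ThompsonGenerators.

(** * Dyadic partitions and fractions *)

(* The subinterval of maximal depth is adjacent to its sibling. *)
Lemma caret_exists N (a k : nat -> nat) : (0 < N)%N -> a 0 = 0 -> (a N).+1 = 2 ^ k N ->
  (forall j, (j < N)%N -> (a j).+1 * 2 ^ k j.+1 = a j.+1 * 2 ^ k j) ->
  exists i, [/\ (i < N)%N, k i.+1 = k i, ~~ odd (a i), a i.+1 = (a i).+1 &
    (0 < k i)%N].
Proof.
move=> N0 a0 aN adj.
have odd_pow2 m n e e' : (m * 2 ^ e = n * 2 ^ e')%N -> odd m -> (e' <= e)%N.
  move=> E om; rewrite leqNgt; apply/negP => ee; move: om.
  have -> : m = (n * 2 ^ (e' - e))%N.
    apply/eqP; rewrite -(eqn_pmul2r (expn_gt0 2 e)) -mulnA -expnD subnK ?E//.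
    exact: ltnW.
  by rewrite oddM oddX subn_eq0 leqNgt ee andbF.
have [j _ kmax] := @arg_maxnP 'I_N.+1 ord0 xpredT (fun j => k j) isT.
have {}kmax i : (i <= N)%N -> (k i <= k j)%N.
  by rewrite -ltnS => iN; exact: (kmax (Ordinal iN)).
have kj : (0 < k j)%N.
  (* With maximal depth 0 the i-th interval would be [i, i + 1], and the last one ends at 1, forcing
     N = 0. *)
  rewrite lt0n; apply/eqP => kj0.
  have k0 i : (i <= N)%N -> k i = 0 by move=> /kmax; rewrite kj0 leqn0 => /eqP.
  have ai i : (i <= N)%N -> a i = i.
    elim: i => // i IH iN; have := adj i iN.
    by rewrite !k0 ?(ltnW iN)// !muln1 IH// ltnW.
  by move: aN; rewrite ai// k0// => -[] N0'; rewrite N0' in N0.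
have sib i : (i < N)%N -> k i.+1 = k i -> a i.+1 = (a i).+1.
  move=> iN ki; have := adj i iN; rewrite ki => /eqP.
  by rewrite eqn_pmul2r ?expn_gt0// => /eqP.
(* An odd numerator at the left end forces the previous interval to be at least as deep. Otherwise
   the right end has an odd numerator, and the next interval is at least as deep. *)
have [oj|ej] := boolP (odd (a j)).
  have [i ji] : exists i, val j = i.+1.
    by exists j.-1; rewrite prednK// lt0n; apply: contraTneq oj => ->; rewrite a0.
  rewrite ji in kmax kj oj *; have iN : (i < N)%N by have := ltn_ord j; rewrite ji.
  have ki : k i.+1 = k i.
    apply/eqP; rewrite eqn_leq kmax ?(ltnW iN)// andbT.
    exact: odd_pow2 (esym (adj i iN)) oj.
  have := sib i iN ki => ai; exists i; split=> //; last by rewrite -ki.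
  by move: oj; rewrite ai.
(* The last interval ends at 1, so its right numerator 2^(k N) is even and it falls under the odd
   case. *)
have jN : (j < N)%N.
  rewrite ltn_neqAle -ltnS ltn_ord andbT; apply: contraNneq ej => jN.
  by move: kj (congr1 odd aN); rewrite jN oddX /= orbF; case: (k N) => // m _ /negbFE.
have ki : k j.+1 = k j.
  by apply/eqP; rewrite eqn_leq kmax//=; exact: odd_pow2 (adj j jN) ej.
by exists j; split=> //; exact: sib.
Qed.

Section Partitions.
Local Open Scope ring_scope.
Variable R : realType.
Implicit Types (b : nat -> R) (f g : thompsonF R).

Lemma pow2_neq0 n : 2 ^+ n != 0 :> R.
Proof. by rewrite expf_neq0// pnatr_eq0. Qed.

Lemma ladder_half N j : (ladder R N j + 1) / 2 = ladder R N.+1 j.+1.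
Proof. by rewrite /ladder ltnS; case: ifP => _; rewrite ?cptS//; field. Qed.

Lemma ladder01 N j : 0 <= ladder R N j <= 1.
Proof. by rewrite /ladder; case: ifP => _; rewrite ?cpt01W// ler01 lexx. Qed.

(** Induction on the number of intervals: merge two siblings [i] and [i.+1], and let [p] map the
    merged partition to the shorter ladder. Then x_i spreads the two halves over consecutive rungs,
    fixes what lies to their left and shifts by one rung what lies to their right. *)
Lemma partition_word N b (a k : nat -> nat) : b 0%N = 0 -> b N.+1 = 1 ->
  (forall j, (j <= N)%N -> b j = (a j)%:R / 2 ^+ k j /\
     b j.+1 = (a j).+1%:R / 2 ^+ k j) ->
  exists p, forall j, (j <= N)%N ->
    affine_on (XF R p) (b j) (b j.+1) (ladder R N j) (ladder R N j.+1).
Proof.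
elim: N b a k => [|N IH] b a k b0 bN bj.
  exists [::] => -[|//] _; rewrite b0 bN /ladder /= cpt0 /XF big_nil.
  exact: affine_id.
have eqdiv (m n : nat) e e' : m%:R / 2 ^+ e = n%:R / 2 ^+ e' :> R ->
    (m * 2 ^ e' = n * 2 ^ e)%N.
  move=> /eqP; rewrite eqr_div ?pow2_neq0// -!natrX -!natrM eqr_nat => /eqP->.
  by [].
have a0 : a 0%N = 0%N.
  have [+ _] := bj 0%N isT; rewrite b0 -(mul0r (2 ^+ 0)^-1) => /esym/(@eqdiv _ 0%N).
  by rewrite muln1.
have aN : (a N.+1).+1 = (2 ^ k N.+1)%N.
  have h : (a N.+1).+1%:R / 2 ^+ k N.+1 = 1%:R / 2 ^+ 0 :> R.
    by rewrite expr0 divr1; have [_ <-] := bj N.+1 (leqnn _).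
  by have := eqdiv _ _ _ _ h; rewrite muln1 mul1n.
have [|i [iN ki ei ai k0]] := caret_exists (ltn0Sn N) a0 aN.
  move=> j jN; have [_ e1] := bj j (ltnW jN); have [e2 _] := bj j.+1 jN.
  by apply: eqdiv; rewrite -e1 -e2.
(* Drops the point [b i.+1]. The merged interval has half the numerator of its left sibling and one
   level of depth less. *)
pose skip (T : Type) (c : nat -> T) j := if (j <= i)%N then c j else c j.+1.
pose a' j := if j == i then (a i)./2 else skip _ a j.
pose k' j := if j == i then (k i).-1 else skip _ k j.
have mid : (b i + b i.+2) / 2 = b i.+1.
  have [-> ->] := bj i (ltnW iN); have [_ ->] := bj i.+1 iN; rewrite ki ai.
  rewrite -(addn2 (a i)) natrD -(addn1 (a i)) natrD.
  by move: (pow2_neq0 (k i)); move: (2 ^+ k i) => z z0; field.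
have merged : b i = (a i)./2%:R / 2 ^+ (k i).-1 /\ b i.+2 = (a i)./2.+1%:R / 2 ^+ (k i).-1.
  have ae : (a i)%:R = 2 * (a i)./2%:R :> R.
    by rewrite -natrM mul2n -[in LHS](odd_double_half (a i)) (negbTE ei).
  have ke : 2 ^+ k i = 2 * 2 ^+ (k i).-1 :> R by rewrite -exprS prednK.
  have [-> _] := bj i (ltnW iN); have [_ ->] := bj i.+1 iN; rewrite ki ai.
  rewrite -(addn2 (a i)) natrD -(addn1 _./2) natrD ae ke.
  move: (pow2_neq0 (k i).-1); move: (2 ^+ _) => z z0.
  by split; field.
have [||j jN|p Hp] := IH (skip _ b) a' k'.
- by rewrite /skip.
- by rewrite /skip leqNgt iN.
- rewrite /a' /k' /skip; case: (ltngtP j i) => [ji|ij|->].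
  + by apply: bj; exact: leqW.
  + exact: bj.
  + exact: merged.
have low j : (j < i)%N -> affine_on (XF R p) (b j) (b j.+1) (cpt R j) (cpt R j.+1).
  move=> ji; have := Hp j (leq_trans (ltnW ji) iN).
  by rewrite /skip /ladder (ltnW ji) ji (leq_trans ji iN) (leq_trans (ltnW ji) iN).
have high j : (i < j)%N -> (j <= N)%N ->
    affine_on (XF R p) (b j.+1) (b j.+2) (cpt R j) (ladder R N j.+1).
  move=> ij jN; have := Hp j jN; rewrite /skip leqNgt ij /= leqNgt (leqW ij) /=.
  by rewrite {1}/ladder jN.
have := Hp i iN; rewrite /skip leqnn ltnn {1}/ladder (iN : (i <= N)%N) => Hi.
have := affine_left Hi; have := affine_right Hi; rewrite mid => Hr Hl.
have [iN'|Ni] := ltnP i N.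
  exists (i :: p) => j jN; rewrite XF_cons.
  have lad m : (m <= N.+1)%N -> ladder R N.+1 m = cpt R m by rewrite /ladder => ->.
  have [ji|ij|ij] := ltngtP j i.
  - rewrite !lad//; last exact: leq_trans ji (ltnW iN).
    apply: affine_comp (low j ji) _.
    have := cpt01 R j => cj.
    apply: xF_below; [by lra|exact/ltW/cpt_lt|].
    by move: ji; rewrite leq_eqVlt => /orP[/eqP->//|/(cpt_lt R)/ltW].
  - case: j jN ij => // j jN; rewrite ltnS leq_eqVlt => /orP[/eqP<-|ij].
      rewrite !lad//.
      by move: Hr; rewrite /ladder iN' => Hr; apply: affine_comp Hr (xF_right i).
    rewrite -(ladder_half N j) -(ladder_half N j.+1) [ladder R N j]/ladder (jN : (j <= N)%N).
    apply: affine_comp (high j ij jN) _; apply: xF_above.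
    + by move: ij; rewrite leq_eqVlt => /orP[/eqP->//|/(cpt_lt R)/ltW].
    + by have := @ladderS R N j jN; rewrite {1}/ladder (jN : (j <= N)%N).
    + by have /andP[] := ladder01 N j.+1.
  - rewrite ij !lad//; last exact: leqW.
    by move: Hl; rewrite /ladder iN' => Hl; apply: affine_comp Hl (xF_left i).
(* The merged interval is the last one: it is sent to [c_N, 1], whose midpoint is already c_(N+1),
   so [p] alone works. *)
have eN : i = N by apply/eqP; rewrite eqn_leq Ni -ltnS iN.
have tl : ladder R N i.+1 = 1 by rewrite /ladder eN ltnn.
rewrite tl -cptS in Hl Hr.
exists p => j; rewrite leq_eqVlt => /orP[/eqP->|].
  by rewrite -eN {2}/ladder eN ltnn {1}/ladder leqnn -eN.
rewrite ltnS leq_eqVlt => /orP[/eqP->|jN].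
  by rewrite -eN /ladder eN leqnn leqW// -eN.
rewrite /ladder !leqW ?(ltnW jN)//; apply: low; by rewrite eN.
Qed.
End Partitions.

(** * Elements of F as fractions of positive words *)

Section Factorization.
Local Open Scope ring_scope.
Variable R : realType.
Implicit Types (x u v : R) (f g : thompsonF R).
Local Notation I01 := (set_type (@unit_interval R)).

Definition dyadic_at n x := exists m : int, x = m%:~R / 2 ^+ n.

Lemma dyadic_atW n n' x : (n <= n')%N -> dyadic_at n x -> dyadic_at n' x.
Proof.
move=> /subnKC <- [m ->]; exists (m * 2 ^+ (n' - n)).
rewrite rmorphM rmorphXn /= exprD.
move: (pow2_neq0 R n) (pow2_neq0 R (n' - n)).
by move: (2 ^+ n) (2 ^+ (n' - n)) => y z y0 z0; field; rewrite y0 z0.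
Qed.

Lemma dyadic_at_seq (s : seq I01) : (forall t, t \in s -> dyadic (val t)) ->
  exists n, forall t, t \in s -> dyadic_at n (val t).
Proof.
elim: s => [|t s IH] sd; first by exists 0%N.
have [|n Hn] := IH; first by move=> u us; apply: sd; rewrite inE us orbT.
have [m [k tE]] := sd t (mem_head _ _).
exists (maxn k n) => u; rewrite inE => /orP[/eqP->|/Hn].
  by apply: dyadic_atW (leq_maxl _ _) _; exists m.
exact: dyadic_atW (leq_maxr _ _).
Qed.

Local Notation grid n j := (j%:R / 2 ^+ n : R).

Lemma pow2_gt0 n : 0 < 2 ^+ n :> R.
Proof. by rewrite exprn_gt0// ltr0n. Qed.

Lemma gridS n j : grid n j.+1 = grid n j + 2 ^- n.
Proof. by rewrite -natr1 mulrDl mul1r. Qed.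

Lemma grid_lt n j : grid n j < grid n j.+1.
Proof. by rewrite gridS ltrDl invr_gt0 pow2_gt0. Qed.

Lemma grid_ge0 n j : 0 <= grid n j.
Proof. by rewrite divr_ge0// ltW// pow2_gt0. Qed.

Lemma grid_le1 n j : (j <= 2 ^ n)%N -> grid n j <= 1.
Proof. by move=> jn; rewrite ler_pdivrMr ?pow2_gt0// mul1r -natrX ler_nat. Qed.

Lemma dyadic_at_between n j x : dyadic_at n x -> ~~ (grid n j < x < grid n j.+1).
Proof.
move=> [m ->]; apply/negP; rewrite !ltr_pM2r ?invr_gt0 ?pow2_gt0//.
rewrite -[j%:R]/(j%:Z%:~R) -[j.+1%:R]/(j.+1%:Z%:~R) !ltr_int => /andP[jm mj].
by lia.
Qed.

(** Where f is x -> 2^k x + c, cells of level n go to cells of level n - k as soon as c is a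
    multiple of 2^-(n - k). Here c is dyadic because f preserves dyadic numbers. *)
Lemma locally_standard f n0 i : (i < 2 ^ n0)%N ->
  (exists (k : int) (c : R), forall x, grid n0 i <= x <= grid n0 i.+1 ->
     ev f x = 2 ^ k * x + c) ->
  exists E, forall n, (E <= n)%N -> forall j,
    grid n0 i <= grid n j -> grid n j.+1 <= grid n0 i.+1 ->
    exists ka : nat * nat,
      affine_on f (grid n j) (grid n j.+1) (grid ka.1 ka.2) (grid ka.1 ka.2.+1).
Proof.
move=> iN [k [c fE]].
have [e [m cE]] : exists e, dyadic_at e c.
  have -> : c = ev f (grid n0 i) + - (2 ^ k * grid n0 i).
    by rewrite fE ?lexx ?ltW ?grid_lt//; ring.
  have di : dyadic (grid n0 i) by exists i%:Z, n0.
  have [m [e ->]] : dyadic (ev f (grid n0 i) + - (2 ^ k * grid n0 i)).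
    by apply: dyadicD; [exact: ev_dyadic|apply/dyadicN/dyadicZ].
  by exists e, m.
(* This bound makes K = n - k a natural number with e <= K. *)
exists (`|k| + e)%N => n nE j ij ji.
have [K nK] : exists K : nat, n%:Z - k = K%:Z.
  by exists `|n%:Z - k|%N; rewrite gez0_abs//; lia.
have eK : (e <= K)%N by lia.
have slope : 2 ^ k * 2 ^- n = 2 ^- K :> R.
  rewrite !exprnN -expfzDr ?pnatr_eq0//; congr (_ ^ _); lia.
have fgrid i' : grid n0 i <= grid n i' <= grid n0 i.+1 ->
    ev f (grid n i') = (i'%:Z + m * 2 ^+ (K - e))%:~R / 2 ^+ K.
  move=> hi; rewrite fE// cE mulrCA slope rmorphD rmorphM rmorphXn /= mulrDl.
  congr (_ + _); rewrite -{2}(subnKC eK) exprD.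
  move: (pow2_neq0 R e) (pow2_neq0 R (K - e)).
  by move: (2 ^+ e) (2 ^+ (K - e)) => y z y0 z0; field; rewrite y0 z0.
have lt := grid_lt n j.
have h1 := fgrid j; have h2 := fgrid j.+1.
rewrite ij (le_trans (ltW lt) ji) in h1; rewrite ji (le_trans ij (ltW lt)) in h2.
set A := j%:Z + _ in h1 *.
have A0 : 0 <= A.
  have /andP[+ _] := ev01 f (grid n j); rewrite h1//.
  by rewrite pmulr_lge0 ?invr_gt0 ?pow2_gt0// ler0z.
exists (K, `|A|%N) => /=.
have AE : `|A|%N%:R = A%:~R :> R by rewrite -[LHS]/(`|A|%N%:Z%:~R) gez0_abs.
apply: (affineP (A := 2 ^ k) (B := c)); first exact: ltW.
- by rewrite AE -h1// fE// ij (le_trans (ltW lt) ji).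
- rewrite -fE; last by rewrite ji (le_trans ij (ltW lt)).
  rewrite h2// -natr1 AE; congr (_ / _).
  by rewrite -[1]/(1%:~R) -rmorphD; congr (_%:~R); rewrite /A; lia.
by move=> x /andP[jx xj]; apply: fE; rewrite (le_trans ij jx) (le_trans xj ji).
Qed.

Lemma bounded_choice (P : nat -> nat -> Prop) M :
  (forall i, (i < M)%N -> exists E, forall n, (E <= n)%N -> P i n) ->
  exists E, forall n, (E <= n)%N -> forall i, (i < M)%N -> P i n.
Proof.
elim: M => [|M IH] H; first by exists 0%N.
have [i iM|E HE] := IH; first by apply: H; exact: ltnW.
have [E' HE'] := H M (ltnSn M).
exists (maxn E E') => n; rewrite geq_max => /andP[En En'] i.
by rewrite ltnS leq_eqVlt => /orP[/eqP->|/HE]; [exact: HE'|apply].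
Qed.

(** All breakpoints are multiples of some 2^-n0, so f is affine on each cell of level n0; these are
    finitely many and admit a common finer level. *)
Lemma standard_subdivision f : exists n, forall j, (j < 2 ^ n)%N ->
  exists ka : nat * nat,
    affine_on f (grid n j) (grid n j.+1) (grid ka.1 ka.2) (grid ka.1 ka.2.+1).
Proof.
have [_ _ [s [sd sP]]] := thompsonP f.
have [n0 sn0] := dyadic_at_seq sd.
have loc i : (i < 2 ^ n0)%N -> exists (k : int) (c : R),
    forall x, grid n0 i <= x <= grid n0 i.+1 -> ev f x = 2 ^ k * x + c.
  move=> iN; have in01 x : grid n0 i <= x <= grid n0 i.+1 -> 0 <= x <= 1.
    case/andP=> ix xi; rewrite (le_trans (grid_ge0 n0 i) ix).
    exact: le_trans xi (grid_le1 iN).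
  have lt := grid_lt n0 i.
  have e1 : val (to01 (grid n0 i)) = grid n0 i by rewrite to01K// in01 ?lexx ?ltW.
  have e2 : val (to01 (grid n0 i.+1)) = grid n0 i.+1.
    by rewrite to01K// in01 ?lexx ?ltW.
  have [||k [c H]] := sP (to01 (grid n0 i)) (to01 (grid n0 i.+1)).
  - by rewrite e1 e2.
  - by move=> t ts; rewrite e1 e2; apply: dyadic_at_between; exact: sn0.
  exists k, c => x xi; have x01 := in01 x xi; rewrite /ev H; first by rewrite to01K.
  by rewrite e1 e2 to01K.
have [E HE] := bounded_choice (fun i iN => locally_standard iN (loc i iN)).
pose n := maxn n0 E; exists n => j jn.
have n0n : (n0 <= n)%N := leq_maxl _ _.
have dgt0 : (0 < 2 ^ (n - n0))%N by rewrite expn_gt0.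
have e : (2 ^ n = 2 ^ n0 * 2 ^ (n - n0))%N by rewrite -expnD subnKC.
have cmp a b : (grid n0 a <= grid n b) = (a * 2 ^ (n - n0) <= b)%N.
  rewrite ler_pdivrMr ?pow2_gt0// mulrAC ler_pdivlMr ?pow2_gt0//.
  by rewrite -!natrX -!natrM ler_nat e mulnCA [(b * _)%N]mulnC leq_pmul2l ?expn_gt0.
have cmp' a b : (grid n b <= grid n0 a) = (b <= a * 2 ^ (n - n0))%N.
  rewrite ler_pdivrMr ?pow2_gt0// mulrAC ler_pdivlMr ?pow2_gt0//.
  by rewrite -!natrX -!natrM ler_nat e mulnCA [(b * _)%N]mulnC leq_pmul2l ?expn_gt0.
(* The quotient is the index of the cell of level [n0] that contains the j-th cell of level [n]. *)
apply: (HE n (leq_maxr _ _) (j %/ 2 ^ (n - n0))%N).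
- by rewrite ltn_divLR// -e.
- by rewrite cmp leq_divM.
- by rewrite cmp' ltn_ceil.
Qed.

Lemma uniform_word n : exists p, forall j, (j < 2 ^ n)%N ->
  affine_on (XF R p) (grid n j) (grid n j.+1)
    (ladder R (2 ^ n).-1 j) (ladder R (2 ^ n).-1 j.+1).
Proof.
have [||j jN|p Hp] := @partition_word R (2 ^ n).-1 (fun j => grid n j) id (fun=> n).
- exact: mul0r.
- by rewrite prednK ?expn_gt0// natrX divff// pow2_neq0.
- by [].
by exists p => j jn; apply: Hp; rewrite -ltnS prednK ?expn_gt0.
Qed.

Lemma grid_cover n x : 0 <= x <= 1 ->
  exists2 j, (j < 2 ^ n)%N & grid n j <= x <= grid n j.+1.
Proof.
move=> /andP[x0 x1].
suff H M : (0 < M)%N -> (M <= 2 ^ n)%N -> x <= grid n M ->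
    exists2 j, (j < 2 ^ n)%N & grid n j <= x <= grid n j.+1.
  by apply: (H (2 ^ n)%N); rewrite ?expn_gt0// natrX divff ?pow2_neq0.
elim: M => // m IH _ mn xm.
have [mx|/ltW xm'] := leP (grid n m) x; first by exists m; rewrite ?mx.
case: m IH mn xm xm' => [|m] IH mn xm xm'.
  by exists 0%N; rewrite // xm mul0r x0.
by apply: IH => //; exact: ltnW.
Qed.

(** A fine uniform partition and its image under f are both standard and have equally many
    intervals, so p and q carry them to the same ladder. Then q f and p are the same affine map on
    each cell. *)
Theorem thompson_fractions f : exists p q, (XF R q * f = XF R p)%g.
Proof.
have [n Hn] := standard_subdivision f.
have N1 : (2 ^ n).-1.+1 = (2 ^ n)%N by rewrite prednK// expn_gt0.
have [p Hp] := uniform_word n.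
have /choice [ka Hka] : forall j, exists ka : nat * nat, (j < 2 ^ n)%N ->
    affine_on f (grid n j) (grid n j.+1) (grid ka.1 ka.2) (grid ka.1 ka.2.+1).
  move=> j; case: (ltnP j (2 ^ n)) => [/Hn[ka H]|_]; last by exists (0, 0)%N.
  by exists ka.
have [||j|q Hq] := @partition_word R (2 ^ n).-1 (fun j => ev f (grid n j))
    (fun j => (ka j).2) (fun j => (ka j).1).
- by rewrite mul0r ev_0.
- by rewrite N1 natrX divff ?pow2_neq0// ev_1.
- rewrite -ltnS N1 => /Hka H.
  by rewrite (affine_l H) (affine_r H).
exists p, q; apply: ev_ext => x x01.
have [j jn xj] := grid_cover n x01.
apply: affine_eq xj; last exact: Hp.
have H := Hka j jn; apply: (affine_comp H).
rewrite -(affine_l H) -(affine_r H).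
by apply: Hq; rewrite -ltnS N1.
Qed.

(** The point is the a-th one of a uniform grid, 0 < a < 2^n, and the word of [uniform_word] sends
    it to c_a. *)
Lemma dyadic_to_ladder x : dyadic x -> 0 < x < 1 ->
  exists p j, ev (XF R p) x = cpt R j.+1.
Proof.
case=> [[a|a] [n xE]] /andP[x0 x1]; last first.
  by move: x0; rewrite xE pmulr_lgt0 ?invr_gt0 ?pow2_gt0// ltr0z.
have [p Hp] := uniform_word n.
have a0 : (0 < a)%N.
  by move: x0; rewrite xE pmulr_lgt0 ?invr_gt0 ?pow2_gt0// ltr0z.
have an : (a < 2 ^ n)%N.
  by move: x1; rewrite xE ltr_pdivrMr ?pow2_gt0// mul1r -natrX ltr_nat.
case: a a0 an xE => // a _ an xE; exists p, a.
rewrite xE (affine_l (Hp _ an)) /ladder.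
by rewrite -ltnS prednK ?expn_gt0// an.
Qed.
End Factorization.

(** * Permutational wreath products *)

Section WreathElements.
Local Open Scope group_scope.
Variables (W G : groupType) (X : choiceType) (act : gaction G X).
Implicit Types (f : fs_group X W) (g : G) (x y : X) (v : W).
Local Notation Gamma := (wreath W act).

Definition fsingle x v : fs_group X W := [fsfun y in [fset x]%fset => v | 1].

Lemma fsingleE x v y : fsingle x v y = if y == x then v else 1.
Proof. by rewrite fsfunE in_fset1. Qed.

Lemma fs_mulgE f f' x : (f * f') x = f x * f' x.
Proof. exact: fs_mulE. Qed.
Lemma fs_1gE x : (1 : fs_group X W) x = 1.
Proof. exact: fs_oneE. Qed.

Definition top g : Gamma := Semidirect _ 1 g.
Definition base f : Gamma := Semidirect _ f 1.
Definition lamp x v : Gamma := base (fsingle x v).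

Lemma wreath_mulE (z t : Gamma) : z * t =
  Semidirect _ (sd_left z * wr_act act (sd_right z) (sd_left t)) (sd_right z * sd_right t).
Proof. by []. Qed.

Lemma wreath_eq (z t : Gamma) : (forall x, sd_left z x = sd_left t x) ->
  sd_right z = sd_right t -> z = t.
Proof. by case: z t => [f g] [f' g'] /= /fsfunP -> ->. Qed.

Lemma wr_act_1 g : wr_act act g (1 : fs_group X W) = 1.
Proof. by apply/fsfunP => x; rewrite wr_actE !fs_1gE. Qed.

Lemma wr_act_single g x v : wr_act act g (fsingle x v) = fsingle (act g x) v.
Proof.
apply/fsfunP => y; rewrite wr_actE !fsingleE; congr (if _ then _ else _).
apply/eqP/eqP => [<-|->]; first by rewrite -gactM mulgV gact1.
by rewrite -gactM mulVg gact1.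
Qed.

Lemma topM g h : top (g * h) = top g * top h.
Proof. by rewrite wreath_mulE /= wr_act_1 mulg1. Qed.
Lemma topV g : top g^-1 = (top g)^-1.
Proof. by apply: (mulgI (top g)); rewrite -topM !mulgV. Qed.
Lemma baseM f f' : base (f * f') = base f * base f'.
Proof. by rewrite wreath_mulE /= wr_act1 mulg1. Qed.
Lemma base_top f g : base f * top g = Semidirect _ f g.
Proof. by rewrite wreath_mulE /= wr_act_1 mulg1 mul1g. Qed.
Lemma lampM x v v' : lamp x (v * v') = lamp x v * lamp x v'.
Proof.
rewrite -baseM; congr base; apply/fsfunP => y; rewrite fs_mulgE !fsingleE.
by case: eqP => // _; rewrite mulg1.
Qed.
Lemma lamp1 x : lamp x 1 = 1.
Proof.
by apply: wreath_eq => //= y; rewrite fsingleE fs_1gE; case: ifP.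
Qed.
Lemma lampV x v : lamp x v^-1 = (lamp x v)^-1.
Proof. by apply: (mulgI (lamp x v)); rewrite -lampM !mulgV lamp1. Qed.

Lemma top_lamp g x v : top g * lamp x v = lamp (act g x) v * top g.
Proof.
by rewrite base_top wreath_mulE /= wr_act_single mul1g mulg1.
Qed.

Lemma lamp_commute x y v v' : x != y -> commute (lamp x v) (lamp y v').
Proof.
move=> xy; rewrite /commute -!baseM; congr base; apply/fsfunP => z.
rewrite !fs_mulgE !fsingleE; have [->|_] := eqVneq z x.
  by rewrite (negbTE xy) mulg1 mul1g.
by case: ifP => _; rewrite ?mul1g ?mulg1.
Qed.

Lemma word_eval_lamp n (a : 'I_n -> W) x w :
  word_eval (fun s => lamp x (a s)) w = lamp x (word_eval a w).
Proof.
elim: w => [|[s b] w IH]; first by rewrite !word_eval_nil lamp1.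
by rewrite !word_eval_cons lampM IH /letter_eval; case: b => //=; rewrite lampV.
Qed.

Lemma letter_eval_lamp n (a : 'I_n -> W) x c :
  letter_eval (fun s => lamp x (a s)) c = lamp x (letter_eval a c).
Proof. by rewrite /letter_eval; case: c => s [] //=; rewrite lampV. Qed.

Lemma base_prod f : base f = \prod_(x <- finsupp f) lamp x (f x).
Proof.
have -> : \prod_(x <- finsupp f) lamp x (f x) =
    base (\prod_(x <- finsupp f) fsingle x (f x)).
  elim: (enum_fset _) => [|x s IH]; first by rewrite !big_nil.
  by rewrite !big_cons IH baseM.
congr base; apply/fsfunP => y.
have : uniq (enum_fset (finsupp f)) by exact: fset_uniq.
have -> : f y = if y \in enum_fset (finsupp f) then f y else 1.
  by case: ifPn => // yf; apply: fsfun_dflt.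
elim: (enum_fset _) => [|x s IH] /=; first by rewrite big_nil fs_1gE.
move=> /andP[xs /IH {}IH]; rewrite big_cons fs_mulgE fsingleE -IH inE.
by have [->|_] := eqVneq y x; rewrite ?(negbTE xs) ?mulg1 ?mul1g.
Qed.
End WreathElements.

(** * Generated elements and the finite list of relators *)

Section Reached.
Local Open Scope group_scope.
Variables (G : groupType) (n : nat) (a : 'I_n -> G).

Definition reached g := exists w : word n, word_eval a w = g.

Lemma reached1 : reached 1.
Proof. by exists [::]; rewrite word_eval_nil. Qed.
Lemma reachedM g h : reached g -> reached h -> reached (g * h).
Proof. by move=> [u <-] [v <-]; exists (u ++ v); rewrite word_eval_cat. Qed.
Lemma reachedV g : reached g -> reached g^-1.
Proof. by move=> [u <-]; exists (word_inv u); rewrite word_eval_inv. Qed.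
Lemma reached_gen i : reached (a i).
Proof. by exists [:: (i, false)]; rewrite word_eval_cons word_eval_nil mulg1. Qed.
Lemma reachedX g m : reached g -> reached (g ^+ m).
Proof.
move=> rg; elim: m => [|m IH]; first exact: reached1.
by rewrite expgS; exact: reachedM.
Qed.
Lemma reached_shift z j g : reached z -> reached g -> reached (zconj z j g).
Proof.
by move=> rz rg; apply: reachedM; [apply: reachedM => //|apply: reachedV]; exact: reachedX.
Qed.
End Reached.

Section ModelFinite.
Local Open Scope group_scope.
Variables (n : nat) (M : model n).

Lemma mx_xgen k : mx M k = xgen (mx M 0) (mx M 1) k.
Proof.
case: k => // k; elim: k => [|k IH]; first by rewrite /= zconj0.
apply: (mulIg (mx M 0)); rewrite -mxx// IH; exact: zconjS.
Qed.

Lemma mw_wgen j s : mw M j s = wgen (mx M 0) (mw M 0) j s.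
Proof.
elim: j => [|j IH]; first by rewrite /wgen zconj0.
apply: (mulIg (mx M 0)); have := mxw M 0 j s; rewrite /bump /= add1n => <-.
rewrite IH; exact: zconjS.
Qed.

Lemma model_finite_relations : finite_relations (mx M 0) (mx M 1) (mw M 0).
Proof.
split=> [||s|s|s|s|s s'].
- by rewrite -(mx_xgen 1) -(mx_xgen 2) -(mx_xgen 3); exact: mxx.
- by rewrite -(mx_xgen 1) -(mx_xgen 3) -(mx_xgen 4); exact: mxx.
- by rewrite -(mx_xgen 1) -(mw_wgen 0); exact: mxw.
- by rewrite -(mx_xgen 2) -(mw_wgen 0); exact: mxw.
- by rewrite -(mx_xgen 1) -(mw_wgen 1) -(mw_wgen 2); exact: mxw.
- by rewrite -(mx_xgen 1) -(mw_wgen 2) -(mw_wgen 3); exact: mxw.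
- by rewrite -(mw_wgen 0) -(mw_wgen 1); exact: mww.
Qed.

Lemma mx_reached k : reached (mgen M) (mx M k).
Proof.
have x0 : reached (mgen M) (mx M 0).
  by rewrite -(mgen_lshift M ord0); exact: reached_gen.
have x1 : reached (mgen M) (mx M 1).
  by rewrite -(mgen_lshift M (lift ord0 ord0)); exact: reached_gen.
by rewrite mx_xgen; case: k => // k; exact: reached_shift.
Qed.

Lemma mw_reached j s : reached (mgen M) (mw M j s).
Proof.
have w0 : reached (mgen M) (mw M 0 s) by rewrite -mgen_rshift; exact: reached_gen.
by rewrite mw_wgen; apply: reached_shift => //; exact: mx_reached.
Qed.
End ModelFinite.

Section Relators.
Local Open Scope group_scope.
Variables (n : nat) (r : seq (word n)).
Let letter0 : 'I_(2 + n) := lshift n ord0.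
Let letter1 : 'I_(2 + n) := lshift n (lift ord0 ord0).

Definition word_shift j (w : word (2 + n)) : word (2 + n) :=
  nseq j (letter0, false) ++ w ++ nseq j (letter0, true).
Definition word_lamp (w : word n) : word (2 + n) :=
  [seq (rshift 2 l.1, l.2) | l <- w].
Definition word_x k : word (2 + n) :=
  if k is k'.+1 then word_shift k' [:: (letter1, false)] else [:: (letter0, false)].
Definition word_w j s : word (2 + n) := word_shift j [:: (rshift 2 s, false)].
Definition relator (u v : word (2 + n)) := u ++ word_inv v.

(** The equations of [finite_relations], followed by the relators of the lamp group written in its
    copy at index 0. *)
Definition wreath_relators : seq (word (2 + n)) :=
  [:: relator (word_x 1 ++ word_x 2) (word_x 3 ++ word_x 1);
      relator (word_x 1 ++ word_x 3) (word_x 4 ++ word_x 1)] ++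
  [seq relator (word_x 1 ++ word_w 0 s) (word_w 0 s ++ word_x 1) | s <- enum 'I_n] ++
  [seq relator (word_x 2 ++ word_w 0 s) (word_w 0 s ++ word_x 2) | s <- enum 'I_n] ++
  [seq relator (word_x 1 ++ word_w 1 s) (word_w 2 s ++ word_x 1) | s <- enum 'I_n] ++
  [seq relator (word_x 1 ++ word_w 2 s) (word_w 3 s ++ word_x 1) | s <- enum 'I_n] ++
  [seq relator (word_w 0 s ++ word_w 1 t) (word_w 1 t ++ word_w 0 s)
     | s <- enum 'I_n, t <- enum 'I_n] ++
  [seq word_lamp w | w <- r].

Variables (H : groupType) (b : 'I_(2 + n) -> H).
Let t s := b (rshift 2 s).

Lemma word_eval_shift j w :
  word_eval b (word_shift j w) = zconj (b letter0) j (word_eval b w).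
Proof.
rewrite /word_shift !word_eval_cat mulgA; congr (_ * _ * _).
  by elim: j => [|j IH]; rewrite ?word_eval_nil// word_eval_cons IH expgS.
elim: j => [|j IH]; rewrite ?word_eval_nil ?invg1// word_eval_cons IH expgSr.
by rewrite invgM.
Qed.

Lemma word_eval_lamps w : word_eval b (word_lamp w) = word_eval t w.
Proof. by rewrite /word_eval big_map. Qed.

Lemma word_eval_x k : word_eval b (word_x k) = xgen (b letter0) (b letter1) k.
Proof.
case: k => [|k]; last rewrite /= word_eval_shift.
  by rewrite word_eval_cons word_eval_nil mulg1.
by rewrite word_eval_cons word_eval_nil mulg1.
Qed.

Lemma word_eval_w j s : word_eval b (word_w j s) = wgen (b letter0) t j s.
Proof. by rewrite word_eval_shift word_eval_cons word_eval_nil mulg1. Qed.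

Lemma relatorP u v : word_eval b (relator u v) = 1 <-> word_eval b u = word_eval b v.
Proof.
rewrite word_eval_cat word_eval_inv; split=> [/divg1_eq//|->]; exact: mulgV.
Qed.

Lemma wreath_relatorsP : (forall w, w \in wreath_relators -> word_eval b w = 1) <->
  finite_relations (b letter0) (b letter1) t /\
  (forall w, w \in r -> word_eval t w = 1).
Proof.
have E := (word_eval_cat, word_eval_x, word_eval_w).
split=> [H1|[[r1 r2 r3 r4 r5 r6 r7] H2] w].
  have in0 w : w \in wreath_relators -> word_eval b w = 1 := H1 w.
  move: in0; rewrite /wreath_relators => in0; split; last first.
    move=> w wr; rewrite -word_eval_lamps; apply: in0.
    by rewrite !mem_cat map_f ?orbT.
  split.
  - have /relatorP := in0 _ (mem_head _ _); by rewrite !E.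
  - have /relatorP : word_eval b (relator (word_x 1 ++ word_x 3) (word_x 4 ++ word_x 1)) = 1.
      by apply: in0; rewrite inE mem_head orbT.
    by rewrite !E.
  - move=> s; rewrite -!E; apply/relatorP/in0; rewrite !mem_cat.
    by rewrite (map_f (fun s => relator (word_x 1 ++ word_w 0 s) _)) ?mem_enum ?orbT.
  - move=> s; rewrite -!E; apply/relatorP/in0; rewrite !mem_cat.
    by rewrite (map_f (fun s => relator (word_x 2 ++ word_w 0 s) _)) ?mem_enum ?orbT.
  - move=> s; rewrite -!E; apply/relatorP/in0; rewrite !mem_cat.
    by rewrite (map_f (fun s => relator (word_x 1 ++ word_w 1 s) _)) ?mem_enum ?orbT.
  - move=> s; rewrite -!E; apply/relatorP/in0; rewrite !mem_cat.
    by rewrite (map_f (fun s => relator (word_x 1 ++ word_w 2 s) _)) ?mem_enum ?orbT.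
  - move=> s s'; rewrite -!E; apply/relatorP/in0; rewrite !mem_cat.
    by rewrite (allpairs_f (fun s t => relator (word_w 0 s ++ word_w 1 t) _)) ?mem_enum ?orbT.
rewrite !mem_cat !inE -!orbA.
case/or4P => [/eqP->|/eqP->|/mapP[s _ ->]|]; try by apply/relatorP; rewrite !E.
case/or4P => [/mapP[s _ ->]|/mapP[s _ ->]|/mapP[s _ ->]|]; try by apply/relatorP; rewrite !E.
case/orP => [/allpairsP[[s s'] [_ _ ->]]|/mapP[u /H2 ur ->]].
  by apply/relatorP; rewrite !E.
by rewrite word_eval_lamps.
Qed.
End Relators.

(** * Presentation of the wreath product over F *)

Section ThompsonWreath.
Local Open Scope group_scope.
Variables (R : realType) (W : groupType).
Local Notation X := (dyadic_interior R).
Local Notation Gamma := (wreath W (eval_action R)).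

Lemma pt_subproof j :
  `[< dyadic (val (to01 (cpt R j.+1))) /\ (0 < val (to01 (cpt R j.+1)) < 1)%R >].
Proof.
apply/asboolP; rewrite to01K ?cpt01W//; split; first exact: cpt_dyadic.
by have := cpt_lt R (ltn0Sn j); have := cpt01 R j.+1; rewrite cpt0 => /andP[_ ->] ->.
Qed.
Definition pt j : X := exist _ (to01 (cpt R j.+1)) (pt_subproof j).

Lemma val_pt j : val (val (pt j)) = cpt R j.+1.
Proof. by rewrite to01K// cpt01W. Qed.

Lemma pt_inj : injective pt.
Proof. by move=> i j E; apply/succn_inj/(@cpt_inj R); rewrite -!val_pt E. Qed.

Lemma val_eval f (x : X) : val (val (eval_action R f x)) = ev f (val (val x)).
Proof. by rewrite ev_val. Qed.

Lemma xF_pt i j : eval_action R (xF R i) (pt j) = pt (bump i j).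
Proof.
apply: val_inj; apply: val_inj; rewrite val_eval !val_pt xF_cpt; congr cpt.
by rewrite /bump; case: ltnP.
Qed.

Lemma dyadic_to_pt (x : X) : exists p j, eval_action R (XF R p) x = pt j.
Proof.
case: (x) (asboolW (valP x)) => z /= zP [dz z01].
have [p [j E]] := dyadic_to_ladder dz z01; exists p, j.
by apply: val_inj; apply: val_inj; rewrite val_eval val_pt.
Qed.

Section Generators.
Variables (n : nat) (a : 'I_n -> W).

Let tx k : Gamma := top _ _ (xF R k).
Let tw j s : Gamma := lamp _ (pt j) (a s).

Fact thompson_mxx k m : (k < m)%N -> tx k * tx m = tx m.+1 * tx k.
Proof. by move=> km; rewrite -!topM xF_rel. Qed.
Fact thompson_mxw i j s : tx i * tw j s = tw (bump i j) s * tx i.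
Proof. by rewrite top_lamp xF_pt. Qed.
Fact thompson_mww j k s t : j != k -> commute (tw j s) (tw k t).
Proof. by move=> jk; apply: lamp_commute; rewrite (inj_eq pt_inj). Qed.

Definition thompson_model : model n := Model thompson_mxx thompson_mxw thompson_mww.
Local Notation M0 := thompson_model.

Lemma thompson_mX p : mX M0 p = top _ _ (XF R p) :> Gamma.
Proof.
elim: p => [|i p IH]; first by rewrite mX_nil /XF big_nil.
by rewrite mX_cons IH XF_cons topM.
Qed.

Lemma thompson_mD l : exists2 f : fs_group X W, mD M0 l = base _ f :> Gamma &
  forall j, f (pt j) = word_eval a (collect l j).
Proof.
elim: l => [|[k c] l [f E fE]].
  by exists 1; [rewrite /mD big_nil|move=> j; rewrite word_eval_nil fs_1gE].
exists (fsingle (pt k) (letter_eval a c) * f).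
  rewrite mD_cons E baseM; congr (_ * _); exact: letter_eval_lamp.
move=> j; rewrite fs_mulgE fsingleE fE (inj_eq pt_inj) /collect /= eq_sym.
by case: eqP => _; rewrite ?mul1g// word_eval_cons.
Qed.

(** The F-component determines [bumps] through its action on the c_n, and the lamp at [pt j] is the
    value of the word collected at [j]. So d p = q forces p = q and makes each collected word
    trivial in [W], hence in [M]. *)
Lemma thompson_model_kernel M :
  (forall j w, word_eval a w = 1 -> word_eval (mw M j) w = 1) ->
  forall u, word_eval (mgen M0) u = 1 -> word_eval (mgen M) u = 1.
Proof.
move=> HM; apply: model_kernel => [p q|p q l].
  rewrite !thompson_mX => /(congr1 (@sd_right _ _ _)) /= E j.
  by apply/succn_inj/(@cpt_inj R); rewrite -!XF_cpt E.
have [f E fE] := thompson_mD l; rewrite E !thompson_mX base_top => EE.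
have /= Epq := congr1 (@sd_right _ _ _) EE; have /= Ef := congr1 (@sd_left _ _ _) EE.
by split; [rewrite Epq|move=> j; apply: HM; rewrite -fE Ef fs_1gE].
Qed.

(** Generators give the lamps at the [pt j] and the positive words, and fractions then give all of
    F. A lamp at any dyadic point is conjugate by a positive word to one at some [pt j], and
    products of lamps give the base. *)
Lemma thompson_wreath_generates : generates a -> @generates Gamma _ (mgen M0).
Proof.
move=> gena; rewrite /generates -/(reached _).
have lampj j v : reached (mgen M0) (lamp _ (pt j) v : Gamma).
  have [w <-] := gena v; rewrite -word_eval_lamp.
  elim: w => [|[s b] w IH]; first by rewrite word_eval_nil; exact: reached1.
  rewrite word_eval_cons; apply: reachedM => //.
  have ms := mw_reached M0 j s; rewrite /letter_eval; case: b => //=.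
  exact: reachedV.
have topp p : reached (mgen M0) (top _ _ (XF R p) : Gamma).
  elim: p => [|i p IH]; first by rewrite /XF big_nil; exact: reached1.
  rewrite XF_cons topM; apply: reachedM IH; exact: mx_reached M0 i.
have topf f : reached (mgen M0) (top _ _ f : Gamma).
  have [p [q E]] := thompson_fractions f.
  have -> : f = (XF R q)^-1 * XF R p by rewrite -E mulKg.
  by rewrite topM topV; apply: reachedM => //; exact: reachedV.
have lampx x v : reached (mgen M0) (lamp _ x v : Gamma).
  have [p [j E]] := dyadic_to_pt x.
  have -> : (lamp _ x v : Gamma) =
      (top _ _ (XF R p))^-1 * lamp _ (pt j) v * top _ _ (XF R p).
    by rewrite -E -mulgA -top_lamp mulKg.
  by apply: reachedM => //; apply: reachedM => //; exact: reachedV.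
case=> f g; rewrite -base_top; apply: reachedM => //.
rewrite base_prod; apply: big_ind => [|y z|x _] //; first exact: reached1.
exact: reachedM.
Qed.
End Generators.

(** A family satisfying the relators is the [mgen] of a model, so [thompson_model_kernel] supplies
    the criterion for finite presentation. *)
Lemma wreath_finitely_presented : finitely_presented W -> finitely_presented Gamma.
Proof.
case=> n [a [r [gena pres]]].
have ar w : w \in r -> word_eval a w = 1.
  move=> wr; rewrite -(word_eval_nil a); apply/pres.
  by have := @pres_rel _ r [::] [::] w wr; rewrite cats0.
pose M0 := thompson_model a.
apply: (finitely_presented_crit (a := mgen M0) (r := wreath_relators r)).
- exact: thompson_wreath_generates.
- apply/wreath_relatorsP; split.
    have -> : (fun s => mgen M0 (rshift 2 s)) = mw M0 0.
      by apply/funext => s; rewrite mgen_rshift.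
    by rewrite !mgen_lshift; exact: model_finite_relations.
  move=> w wr; have -> : (fun s => mgen M0 (rshift 2 s)) = mw M0 0.
    by apply/funext => s; rewrite mgen_rshift.
  by rewrite -[LHS]/(word_eval (fun s => lamp _ (pt 0) (a s)) w) word_eval_lamp ar// lamp1.
move=> H b /wreath_relatorsP[fr br] u.
pose M := model_of fr.
have -> : b = mgen M.
  apply/funext => i; rewrite -(splitK i); case: (fintype.split i) => [k|s].
    rewrite mgen_lshift /=.
    by case: k => -[|[|//]] k2; rewrite /= ?zconj0; apply: (congr1 b); apply: val_inj.
  by rewrite mgen_rshift /= /wgen zconj0.
apply: (@thompson_model_kernel _ a M) => j w aw.
(* The lamps at index [j] are conjugates by x_0^j of those at index 0, where the relators of [W]
   hold. *)
have -> : word_eval (mw M j) w = zconj (b (lshift n ord0)) j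
    (word_eval (fun s => b (rshift 2 s)) w).
  elim: w {aw} => [|[s c] w IH].
    by rewrite !word_eval_nil /zconj mulg1 mulgV.
  rewrite !word_eval_cons zconjM IH; congr (_ * _).
  by case: c => //; rewrite /letter_eval /zconj /= !invgM invgK mulgA.
have /pres_eq_sound -> // : pres_eq r w [::].
  by apply/pres; rewrite word_eval_nil.
by rewrite word_eval_nil /zconj mulg1 mulgV.
Qed.
End ThompsonWreath.

(** * Lamp groups *)

Section WordMetric.
Local Open Scope group_scope.

Lemma word_length_le (G : groupType) n (a : 'I_n -> G) (gen : generates a) g w :
  word_eval a w = g -> (word_length gen g <= size w)%N.
Proof.
move=> wg; rewrite /word_length; case: ex_minnP => m _; apply.
by apply/asboolP; exists w.
Qed.

Lemma word_length_attained (G : groupType) n (a : 'I_n -> G) (gen : generates a) g :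
  exists2 w, word_eval a w = g & size w = word_length gen g.
Proof. by rewrite /word_length; case: ex_minnP => m /asboolP. Qed.

(** Edges of the Cayley graph go to edges; the label [d] may depend on the vertex [v], so [phi] need
    not be a homomorphism. *)
Definition edge_map (G H : groupType) m n (a : 'I_m -> G) (b : 'I_n -> H)
  (phi : G -> H) := forall v c, exists d,
  phi (v * letter_eval a c) = phi v * letter_eval b d.

(** A geodesic is mapped edge by edge to a path of the same length. *)
Lemma edge_map_dist (G H : groupType) m n (a : 'I_m -> G) (b : 'I_n -> H) phi
    (gena : generates a) (genb : generates b) :
  edge_map a b phi ->
  forall x y, (word_dist genb (phi x) (phi y) <= word_dist gena x y)%N.
Proof.
move=> lift x y; rewrite {2}/word_dist; have [w wE <-] := word_length_attained gena (x^-1 * y).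
have {wE} : y = x * word_eval a w by rewrite wE mulVKg.
suff [w' <- E] : exists2 w' : word n, size w' = size w &
    phi (x * word_eval a w) = phi x * word_eval b w'.
  by move=> ->; apply: word_length_le; rewrite E mulKg.
elim: w x => [|c w IH] x; first by exists [::]; rewrite ?word_eval_nil ?mulg1.
have [d dE] := lift x c; have [w' sw E] := IH (x * letter_eval a c).
by exists (d :: w'); rewrite /= ?sw// !word_eval_cons mulgA E dE mulgA.
Qed.
End WordMetric.

(** * Isometries between wreath products *)

Section WreathMap.
Local Open Scope group_scope.
Variables (W W' : groupType) (X : choiceType) (phi : W -> W').
Hypothesis phi1 : phi 1 = 1.

Definition fs_map (f : fs_group X W) : fs_group X W' :=
  [fsfun x in finsupp f => phi (f x) | 1].

Lemma fs_mapE f x : fs_map f x = phi (f x).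
Proof. by rewrite fsfunE; case: finsuppP => //=. Qed.

Variables (G : groupType) (act : gaction G X).

Definition wreath_map (z : wreath W act) : wreath W' act :=
  Semidirect _ (fs_map (sd_left z)) (sd_right z).

Lemma wreath_map_top z g : wreath_map (z * top _ _ g) = wreath_map z * top _ _ g.
Proof. by rewrite !wreath_mulE /wreath_map /= !wr_act_1 !mulg1. Qed.

Lemma wreath_map_lamp (z : wreath W act) x v v' :
  phi (sd_left z (act (sd_right z) x) * v) = phi (sd_left z (act (sd_right z) x)) * v' ->
  wreath_map (z * lamp _ x v) = wreath_map z * lamp _ x v'.
Proof.
move=> E; rewrite !wreath_mulE /wreath_map /=; apply: wreath_eq => //= y.
rewrite !wr_act_single fs_mulgE !fs_mapE fs_mulgE !fsingleE.
by case: eqP => [->|_]; rewrite ?mulg1.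
Qed.
End WreathMap.

Lemma wreath_mapK (W W' G : groupType) (X : choiceType) (act : gaction G X)
    (phi : W -> W') (psi : W' -> W) : phi 1%g = 1%g -> psi 1%g = 1%g ->
  cancel phi psi -> cancel (@wreath_map W W' X phi G act) (wreath_map psi (act := act)).
Proof.
move=> phi1 psi1 phiK z; apply: wreath_eq => //= x.
by rewrite !fs_mapE// phiK.
Qed.

Section BilipschitzWreath.
Local Open Scope group_scope.
Variable R : realType.

(** Right multiplication by a generator from F leaves the lamps unchanged. A lamp generator changes
    one lamp, at the image of [pt R 0] under the F-component, by one letter, which [phi] turns into
    one letter of [W']. *)
Lemma thompson_edge_map (W W' : groupType) m n (a : 'I_m -> W) (b : 'I_n -> W')
    (phi : W -> W') : phi 1 = 1 -> edge_map a b phi ->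
  edge_map (mgen (thompson_model R a)) (mgen (thompson_model R b))
    (@wreath_map W W' _ phi _ (eval_action R)).
Proof.
move=> phi1 lift z [i e]; rewrite -(splitK i); case: (fintype.split i) => [k|s].
  exists (lshift n k, e); rewrite /letter_eval /= !mgen_lshift /=.
  by case: e; rewrite -?topV wreath_map_top.
have [[s' e'] E] := lift (sd_left z (eval_action R (sd_right z) (pt R 0))) (s, e).
exists (rshift 2 s', e'); rewrite /letter_eval /= !mgen_rshift /=.
have -> : (if e then (lamp (eval_action R) (pt R 0) (a s))^-1
    else lamp (eval_action R) (pt R 0) (a s)) = lamp _ (pt R 0) (letter_eval a (s, e)).
  by rewrite -letter_eval_lamp.
have -> : (if e' then (lamp (eval_action R) (pt R 0) (b s'))^-1
    else lamp (eval_action R) (pt R 0) (b s')) = lamp _ (pt R 0) (letter_eval b (s', e')).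
  by rewrite -letter_eval_lamp.
exact: wreath_map_lamp.
Qed.

Lemma wreath_bilipschitz (W W' : groupType) m n (a : 'I_m -> W) (b : 'I_n -> W')
    (phi : W -> W') (psi : W' -> W) :
  generates a -> generates b -> phi 1 = 1 -> cancel phi psi -> cancel psi phi ->
  edge_map a b phi -> edge_map b a psi ->
  bilipschitz_equivalent (wreath W (eval_action R)) (wreath W' (eval_action R)).
Proof.
move=> gena genb phi1 phiK psiK ab ba.
have psi1 : psi 1 = 1 by rewrite -phi1 phiK.
pose Phi := @wreath_map W W' _ phi _ (eval_action R).
pose Psi := @wreath_map W' W _ psi _ (eval_action R).
have PhiK : cancel Phi Psi by exact: wreath_mapK.
have PsiK : cancel Psi Phi by exact: wreath_mapK.
(* [Phi] and its inverse do not increase distances, so the constant is 1. *)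
exists _, _, _, _, (thompson_wreath_generates (R := R) gena),
  (thompson_wreath_generates (R := R) genb), Phi, 1%N.
split; first by exists Psi.
move=> x y; rewrite !mul1n; split.
  exact/edge_map_dist/thompson_edge_map.
rewrite -{1}[x]PhiK -{1}[y]PhiK.
exact/edge_map_dist/thompson_edge_map.
Qed.
End BilipschitzWreath.

(** * The infinite cyclic lamp group *)

Section Integers.
Local Open Scope ring_scope.
Local Open Scope group_scope.

Definition zgen (i : 'I_1) : Zgroup := 1%R : int.

Lemma zletter c : letter_eval zgen c = (if c.2 then -1 else 1)%R :> int.
Proof. by case: c => i []. Qed.

Lemma zgroup_mulE (x y : Zgroup) : x * y = ((x : int) + (y : int))%R :> int.
Proof. by []. Qed.

Lemma word_eval_zgen k c :
  word_eval zgen (nseq k (ord0, c)) = ((if c then -1 else 1) * k%:Z)%R :> int.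
Proof.
elim: k => [|k IH]; first by rewrite word_eval_nil mulr0.
by rewrite /= word_eval_cons zgroup_mulE IH zletter /=; case: c {IH}; lia.
Qed.

Lemma zgen_generates : generates zgen.
Proof.
move=> z; exists (nseq `|z : int|%N (ord0, ((z : int) < 0)%R)).
rewrite [LHS]word_eval_zgen; case: ltP => z0.
  by rewrite ltz0_abs//; lia.
by rewrite gez0_abs//; lia.
Qed.

Lemma cyclic_normal_form (u : word 1) : exists k c,
  forall (G : groupType) (b : 'I_1 -> G), word_eval b u = word_eval b (nseq k (ord0, c)).
Proof.
elim: u => [|[i c'] u [k [c H]]]; first by exists 0%N, true.
rewrite (ord1 i); have [->|cc'] := eqVneq c' c.
  by exists k.+1, c => G b; rewrite /= !word_eval_cons H.
case: k H => [|k] H.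
  by exists 1%N, c' => G b; rewrite /= !word_eval_cons H.
exists k, c => G b; rewrite word_eval_cons H /= word_eval_cons mulgA.
by rewrite /letter_eval /=; case: c' c cc' {H} => [] [] // _; rewrite ?mulgV ?mulVg mul1g.
Qed.

Lemma zgroup_finitely_presented : finitely_presented Zgroup.
Proof.
apply: (finitely_presented_crit (a := zgen) (r := [::])) => //.
  exact: zgen_generates.
move=> H b _ u; have [k [c E]] := cyclic_normal_form u; rewrite !E => uz.
suff -> : k = 0%N by rewrite word_eval_nil.
have : ((if c then -1 else 1) * k%:Z)%R = 0%R :> int by rewrite -word_eval_zgen.
by case: c {E uz}; lia.
Qed.
End Integers.

(** * The infinite dihedral lamp group *)

Section InfiniteDihedral.
Local Open Scope ring_scope.
Local Open Scope group_scope.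
Implicit Types (d : Dinf) (s t : bool).

Definition bord s : 'I_2 := if s then lift ord0 ord0 else ord0.
Lemma bord_val (i : 'I_2) : exists s, i = bord s.
Proof. by case: i => -[|[|//]] i2; [exists false|exists true]; apply: val_inj. Qed.

(** The reflection t -> i - t of the integers. *)
Definition dgen (i : 'I_2) : Dinf := Semidirect _ ((i : nat)%:Z : Zgroup) (true : C2group).

(* The position of [d] on the Cayley graph of [dgen], which is a line. *)
Definition dcoord d : Zgroup :=
  (2 * (sd_left d : int) - ((sd_right d : bool) : nat)%:Z)%R.
Definition dpoint (z : Zgroup) : Dinf :=
  Semidirect _ ((((z : int) + 1) %/ 2)%Z : Zgroup) (((z : int) %% 2)%Z == 1%R : C2group).

Lemma dpointK : cancel dpoint dcoord.
Proof.
move=> z; rewrite /dpoint /dcoord /=; case: eqP => /= h; move: (z : int) h => {}z h; lia.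
Qed.
Lemma dcoordK : cancel dcoord dpoint.
Proof.
case=> m b; rewrite /dpoint /dcoord /=; congr Semidirect; move: (m : int) => {}m.
  by case: b => /=; lia.
by case: b => /=; apply/eqP; lia.
Qed.
Lemma dcoord_inj : injective dcoord. Proof. exact: can_inj dcoordK. Qed.

(** At each vertex the two reflections move one step in opposite directions, and these are exchanged
    from one vertex to the next. *)
Lemma dcoordM d s : dcoord (d * dgen (bord s)) =
  (dcoord d + (if (sd_right d : bool) (+) s then 1 else -1) : int)%R.
Proof.
case: d => m b; rewrite /dcoord.
have -> : sd_right (Semidirect sign_autaction m b * dgen (bord s)) = ~~ b by case: b.
have -> : sd_left (Semidirect sign_autaction m b * dgen (bord s)) =
    ((m : int) + (if b then - (s : nat)%:Z else (s : nat)%:Z))%R by case: b; case: s.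
by move: (m : int) => {}m /=; case: b; case: s => /=; lia.
Qed.

Lemma dgen_invol i : dgen i * dgen i = 1.
Proof.
have [s ->] := bord_val i; apply: dcoord_inj; rewrite dcoordM.
by case: s.
Qed.

Lemma sd_right_dgen d s : sd_right (d * dgen (bord s)) = ~~ (sd_right d : bool).
Proof. by case: d => m []. Qed.

Fixpoint alternating k s : word 2 :=
  if k is k'.+1 then (bord s, false) :: alternating k' (~~ s) else [::].

Lemma involution_letter (G : groupType) (b : 'I_2 -> G) : (forall i, b i * b i = 1) ->
  forall c, letter_eval b c = b c.1.
Proof. by move=> bb [i []] //; apply: mulg1_eq; exact: bb. Qed.

Lemma alternating_normal_form (u : word 2) : exists k s,
  forall (G : groupType) (b : 'I_2 -> G), (forall i, b i * b i = 1) ->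
    word_eval b u = word_eval b (alternating k s).
Proof.
elim: u => [|[i e] u [k [s H]]]; first by exists 0%N, true.
have [t ->] := bord_val i; case: k H => [|k] H.
  by exists 1%N, t => G b bb; rewrite /= !word_eval_cons H// !involution_letter.
have [->|ts] := eqVneq t s.
  exists k, (~~ s) => G b bb; rewrite word_eval_cons H//= word_eval_cons.
  by rewrite !involution_letter//= mulgA bb mul1g.
exists k.+2, t => G b bb; rewrite word_eval_cons H//= !word_eval_cons.
by rewrite !involution_letter//=; case: t s ts {H} => [] [].
Qed.

(** Both [sd_right d] and [s] flip at each letter, so an alternating word walks straight along the
    line; only the empty one is trivial. *)
Lemma dcoord_alternating d k s : dcoord (d * word_eval dgen (alternating k s)) =
  (dcoord d + (if (sd_right d : bool) (+) s then 1 else -1) * k%:Z : int)%R.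
Proof.
elim: k d s => [|k IH] d s; first by rewrite word_eval_nil mulg1 mulr0 addr0.
rewrite /= word_eval_cons mulgA /letter_eval /= IH sd_right_dgen dcoordM.
by rewrite addbN addNb negbK; case: (_ (+) _); move: (dcoord d : int) => z; lia.
Qed.

Lemma dgen_generates : generates dgen.
Proof.
move=> d; exists (alternating `|dcoord d : int|%N (0 < (dcoord d : int))%R).
apply: dcoord_inj; rewrite -[X in dcoord X]mul1g dcoord_alternating.
have -> : dcoord 1 = (0%R : int) by [].
move: (dcoord d : int) => z /=; case: ltP => z0.
  by rewrite gtz0_abs//; lia.
by rewrite lez0_abs//; lia.
Qed.

Lemma dinf_finitely_presented : finitely_presented Dinf.
Proof.
pose r := [seq [:: (i, false); (i, false)] | i <- enum 'I_2] : seq (word 2).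
have rE (G : groupType) (b : 'I_2 -> G) i :
    word_eval b [:: (i, false); (i, false)] = b i * b i.
  by rewrite !word_eval_cons word_eval_nil mulg1.
apply: (finitely_presented_crit (a := dgen) (r := r)).
- exact: dgen_generates.
- by move=> w /mapP[i _ ->]; rewrite rE dgen_invol.
move=> H b br u; have [k [s E]] := alternating_normal_form u.
have bb i : b i * b i = 1.
  by rewrite -rE; apply: br; apply: map_f; rewrite mem_enum.
rewrite (E _ _ dgen_invol) (E _ _ bb) => u1; suff -> : k = 0%N by rewrite word_eval_nil.
have := dcoord_alternating 1 k s; rewrite u1 mulg1.
have -> : dcoord 1 = (0%R : int) by [].
by rewrite add0r; case: ifP => _; lia.
Qed.

Lemma dpoint_edge_map : edge_map zgen dgen dpoint.
Proof.
move=> z c; pose d := dpoint z.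
(* Chosen so that the step given by [dcoordM] has the sign of the letter [c]. *)
pose s := (sd_right d : bool) (+) ~~ c.2.
exists (bord s, false); apply: dcoord_inj.
rewrite /letter_eval /= dcoordM !dpointK [LHS]zgroup_mulE -/(letter_eval zgen c) zletter.
by rewrite /s addKb; case: c.2.
Qed.

Lemma dcoord_edge_map : edge_map dgen zgen dcoord.
Proof.
move=> d c; rewrite (involution_letter dgen_invol).
have [s ->] := bord_val c.1; exists (ord0, ~~ ((sd_right d : bool) (+) s)).
by rewrite dcoordM [RHS]zgroup_mulE zletter /=; case: (_ (+) _).
Qed.
End InfiniteDihedral.

(** * Torsion in the two wreath products *)

Section Torsion.
Local Open Scope ring_scope.
Local Open Scope group_scope.

(** If g moves x up or down, monotonicity makes all its positive powers move x the same way, so none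
    fixes x. *)
Lemma thompson_torsion_free (R : realType) : torsion_free (thompsonF R).
Proof.
move=> g [//|n] _ gn; apply: ev_ext => x x01; rewrite ev_id//.
have iter_in m : (0 <= ev (g ^+ m)%g x <= 1)%R := ev01 _ _.
have gnx : ev (g ^+ n.+1) x = x by rewrite gn ev_id.
have [gx|gx|//] := ltgtP (ev g x) x.
- suff H m : (ev (g ^+ m.+1)%g x < x)%R by move: (H n); rewrite gnx ltxx.
  elim: m => [|m IH]; first by rewrite expg1.
  by rewrite expgS evM (lt_trans _ gx)// ev_lt.
- suff H m : (x < ev (g ^+ m.+1)%g x)%R by move: (H n); rewrite gnx ltxx.
  elim: m => [|m IH]; first by rewrite expg1.
  by rewrite expgS evM (lt_trans gx)// ev_lt.
Qed.

Lemma zgroup_torsion_free : torsion_free Zgroup.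
Proof.
move=> z n n0; have -> : z ^+ n = ((z : int) *+ n)%R :> int.
  by elim: n {n0} => // n IH; rewrite expgS mulrS -IH.
by move/eqP; rewrite mulrn_eq0 eqn0Ngt n0 => /eqP.
Qed.

Section WreathTorsion.
Variables (W G : groupType) (X : choiceType) (act : gaction G X).

Lemma sd_right_exp (z : wreath W act) n : sd_right (z ^+ n) = sd_right z ^+ n.
Proof. by elim: n => // n IH; rewrite !expgS wreath_mulE /= IH. Qed.

Lemma fs_expE (f : fs_group X W) n x : (f ^+ n) x = f x ^+ n.
Proof. by elim: n => [|n IH]; rewrite ?fs_1gE// !expgS fs_mulgE IH. Qed.

Lemma base_exp (f : fs_group X W) n : base act f ^+ n = base act (f ^+ n).
Proof. by elim: n => // n IH; rewrite !expgS IH baseM. Qed.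

Lemma wreath_torsion_free : torsion_free W -> torsion_free G ->
  torsion_free (wreath W act).
Proof.
move=> tW tG [f g] n n0 zn.
have g1 : g = 1 by apply: (tG _ n n0); rewrite -(sd_right_exp (Semidirect _ f g)) zn.
move: zn; rewrite g1 -/(base act f) base_exp => /(congr1 (@sd_left _ _ _)) /= fn.
suff -> : f = 1 by [].
by apply/fsfunP => x; rewrite fs_1gE; apply: (tW _ n n0); rewrite -fs_expE fn fs_1gE.
Qed.
End WreathTorsion.

(** The subgroup consists of the lamp configurations with values in {1, s}. Each is its own inverse,
    and the single lamps at the points [p j] make it infinite. *)
Lemma wreath_involutions (W G : groupType) (X : choiceType) (act : gaction G X)
    (s : W) (p : nat -> X) : s != 1 -> s * s = 1 -> injective p ->
  exists H : set (wreath W act),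
    [/\ group_closed (mem H), infinite_set H & has_exponent H 2].
Proof.
move=> s1 ss p_inj.
pose S v := v = 1 \/ v = s.
have SM v w : S v -> S w -> S (v * w).
  by move=> [] -> [] ->; rewrite ?mulg1 ?mul1g ?ss; rewrite /S; auto.
pose H : set (wreath W act) := fun z => exists2 f : fs_group X W,
  z = base act f & forall x, S (f x).
have HP x : H (lamp act x s).
  exists (fsingle x s) => // y; rewrite fsingleE.
  by case: ifP => _; [right|left].
have lamp_inj : injective (fun j => lamp act (p j) s).
  move=> i j /(congr1 (@sd_left _ _ _))/= /(congr1 (fun f : fs_group X W => f (p i))).
  rewrite !fsingleE eqxx; case: eqP => [/p_inj//|_ E].
  by rewrite E eqxx in s1.
have sq (f : fs_group X W) : (forall x, S (f x)) -> base act f * base act f = 1.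
  move=> fS; rewrite -baseM; have -> : f * f = 1 :> fs_group X W; last by [].
  apply/fsfunP => x; rewrite fs_mulgE fs_1gE.
  by case: (fS x) => ->; rewrite ?mulg1.
exists H; split.
- split; first by apply/mem_set; exists 1 => // x; left; rewrite fs_1gE.
  move=> _ _ /set_mem[f -> fS] /set_mem[f' -> fS']; apply/mem_set.
  have -> : (base act f')^-1 = base act f' by apply: mulg1_eq; exact: sq.
  exists (f * f'); first by rewrite baseM.
  by move=> x; rewrite fs_mulgE; exact: SM.
- move=> finH; apply: infinite_nat.
  rewrite -(eq_finite_set (@inj_card_eq _ _ setT _ (in2W lamp_inj))).
  by apply: sub_finite_set finH => _ [j _ <-]; exact: HP.
- split=> // [_ [f -> fS]|[//|[|//]] _ H1]; first by rewrite expg2 sq.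
  have /(congr1 (@sd_left _ _ _))/= := H1 _ (HP (p 0)).
  move=> /(congr1 (fun f : fs_group X W => f (p 0))); rewrite fsingleE eqxx fs_1gE => E.
  by rewrite E eqxx in s1.
Qed.
End Torsion.

Theorem proposition2p12 (R : realType) :
  [/\ finitely_presented (wreath Zgroup (eval_action R)),
      finitely_presented (wreath Dinf (eval_action R)),
      bilipschitz_equivalent
        (wreath Zgroup (eval_action R)) (wreath Dinf (eval_action R)),
      torsion_free (wreath Zgroup (eval_action R)) &
      exists H : set (wreath Dinf (eval_action R)),
        [/\ group_closed (mem H), infinite_set H & has_exponent H 2]].
Proof.
split.
- exact/wreath_finitely_presented/zgroup_finitely_presented.
- exact/wreath_finitely_presented/dinf_finitely_presented.
- apply: (wreath_bilipschitz R zgen_generates dgen_generates _ dpointK dcoordK).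
  + by [].
  + exact: dpoint_edge_map.
  + exact: dcoord_edge_map.
- apply: wreath_torsion_free; first exact: zgroup_torsion_free.
  exact: thompson_torsion_free.
- apply: (@wreath_involutions Dinf (thompsonF R) _ (eval_action R) (dgen ord0) (pt R)).
  + by [].
  + exact: dgen_invol.
  + exact: pt_inj.
Qed.
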